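(* An interval map is a continuous map $f\colon[0,1]\to[0,1]$. (1) For every interval map $f$ of Sharkovskii type $1$, $h_{\mathrm{pol}}(f)\in\mathbb N_0\cup\{\infty\}$, and all these values are possible (each is attained by some interval map of type $1$). (2) For every integer $n\ge1$ and every interval map $f$ of Sharkovskii type $2^n$, $h_{\mathrm{pol}}(f)\in\{n-1,n,n+1,\dots\}\cup\{\infty\}$, and all these values are possible (each is attained by some interval map of type $2^n$). (3) For every interval map $f$ of Sharkovskii type $2^\infty$ or greater (in the Sharkovskii order), $h_{\mathrm{pol}}(f)=\infty$.
   Context: Polynomial entropy: $S$ is $(n,\varepsilon,f)$-separated if $\max_{0\le i\le n-1}|f^i(x)-f^i(y)|>\varepsilon$ for any distinct $x,y\in S$; $\mathrm{sep}(n,\varepsilon,f)$ is the maximal cardinality of an $(n,\varepsilon,f)$-separated set; $h_{\mathrm{pol}}(f)=\lim_{\varepsilon\to0}\limsup_{n\to\infty}\frac{\log\mathrm{sep}(n,\varepsilon,f)}{\log n}$. Sharkovskii type: the Sharkovskii order on $\mathbb N\cup\{2^\infty\}$ is $1\prec2\prec4\prec8\prec\cdots\prec2^\infty\prec\cdots\prec\cdots\prec2^2\cdot7\prec 2^2\cdot5\prec2^2\cdot3\prec\cdots\prec2\cdot7\prec2\cdot5\prec2\cdot3\prec\cdots\prec7\prec5\prec3$. The Sharkovskii type of $f$ is the $\prec$-maximum of the (least) periods of its periodic points, or $2^\infty$ if the set of periods is the set of all powers of $2$. *)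

(* Defs.v *)
From HB Require Import structures.
From mathcomp Require Import all_boot all_order all_algebra.
From mathcomp Require Import finmap.
From mathcomp Require Import all_classical all_reals all_analysis.

Set Implicit Arguments.
Unset Strict Implicit.
Unset Printing Implicit Defensive.

Import Order.TTheory GRing.Theory Num.Theory.
Import numFieldNormedType.Exports.

Local Open Scope classical_set_scope.
Local Open Scope ring_scope.

(* Interval maps are represented by total functions on R; everything below
   depends only on the restriction of f to [0, 1]. *)
Definition interval_map (R : realType) (f : R -> R) : Prop :=
  {within `[0, 1], continuous f} /\ set_fun `[0, 1] `[0, 1] f.

Definition dyn_separated (R : realType) (f : R -> R) (n : nat) (e : R)
    (S : set R) : Prop :=
  S `<=` `[0, 1] /\
  forall x y, S x -> S y -> x <> y ->
    \big[Num.max/0]_(i < n) `|iter i f x - iter i f y| > e.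

(* The supremum of the cardinalities of the finite separated sets. By
   compactness it is a maximum over all separated sets when f is an interval
   map, 0 < n and 0 < e. *)
Definition sep (R : realType) (f : R -> R) (n : nat) (e : R) : \bar R :=
  ereal_sup [set (#|` S|%:R)%:E | S in
    [set S : {fset R} | dyn_separated f n e [set` S]]].

(* The terms n = 0 and n = 1, where the logarithm of n is not positive, do not
   influence the limit superior. The limit in e exists by monotonicity. *)
Definition h_pol (R : realType) (f : R -> R) : \bar R :=
  lim ((limn_esup (fun n : nat => lne (sep f n e) / (ln n%:R)%:E)%E)
       @[e --> (0 : R)^'+]).

Definition periods (R : realType) (f : R -> R) : set nat :=
  [set p | (0 < p)%N /\ exists2 x : R, x \in `[0, 1] &
     iter p f x = x /\ forall k, (0 < k < p)%N -> iter k f x <> x].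

Inductive sharkovskii_index : Type :=
| Period of nat
| TwoInfty.

(* The index [Period 0] is not related to anything. *)
Inductive sharkovskii_lt : sharkovskii_index -> sharkovskii_index -> Prop :=
| SharkPowPow a b : (a < b)%N ->
    sharkovskii_lt (Period (2 ^ a)) (Period (2 ^ b))
| SharkPowInfty a :
    sharkovskii_lt (Period (2 ^ a)) TwoInfty
| SharkPowOdd a b q : odd q -> (1 < q)%N ->
    sharkovskii_lt (Period (2 ^ a)) (Period (2 ^ b * q))
| SharkInftyOdd b q : odd q -> (1 < q)%N ->
    sharkovskii_lt TwoInfty (Period (2 ^ b * q))
| SharkOddExp a b q r : odd q -> (1 < q)%N -> odd r -> (1 < r)%N -> (a < b)%N ->
    sharkovskii_lt (Period (2 ^ b * q)) (Period (2 ^ a * r))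
| SharkOddPart a q r : odd q -> odd r -> (1 < r)%N -> (r < q)%N ->
    sharkovskii_lt (Period (2 ^ a * q)) (Period (2 ^ a * r)).

Definition sharkovskii_le (s t : sharkovskii_index) : Prop :=
  s = t \/ sharkovskii_lt s t.

Definition has_sharkovskii_type (R : realType) (f : R -> R)
    (t : sharkovskii_index) : Prop :=
  match t with
  | Period p => periods f p /\
      forall q, periods f q -> sharkovskii_le (Period q) (Period p)
  | TwoInfty => periods f = [set p | exists k : nat, p = (2 ^ k)%N]
  end.

(* Main.v *)
(* Polynomial entropy is computed by one-way horseshoes of an iterate g of f:
   sequences of k + 1 intervals, consecutive ones disjoint, in which each
   interval g-covers itself and the next one. Following the intervals in order,
   with arbitrary times spent in each, gives binomial(n, k) separated orbits of
   length n, so the entropy is at least k.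

   Conversely let every periodic point be fixed. By Coppel's lemma a point that
   moves up stays above its initial position forever (and symmetrically), so an
   orbit cannot make many consecutive steps of definite size. Cut [0, 1] into
   small pieces so that changing the piece requires a jump of definite size. If
   the large jumps of every orbit fall into k clusters of bounded duration, then
   the orbits of length n are coded by O(n^k) words. If some orbit has k + 1
   clusters far apart in time, then between two clusters it must come close to a
   fixed point and move away from it, and the intervals between these fixed
   points and the orbit form a one-way horseshoe of length k + 1. Hence the
   entropy is the supremum of the lengths of one-way horseshoes. For type 2^n the
   iterate f^(2^n) is of this kind.

   A cycle of period 2^(n+1) of a map whose periods are powers of 2 is exchanged
   by halves, which yields by induction a one-way horseshoe of length n; an odd
   period yields a two-way horseshoe. The examples are obtained from isometries
   by adding a repelling fixed point that reaches everything, which raises the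
   entropy by one, and by period doubling, which raises the entropy by one and
   turns type 2^n into type 2^(n+1). *)
Require Import Defs.
From HB Require Import structures.
From mathcomp Require Import all_boot all_order all_algebra.
From mathcomp Require Import finmap.
From mathcomp Require Import all_classical all_reals all_analysis.
From mathcomp Require Import ring lra zify.
Set Implicit Arguments.
Unset Strict Implicit.
Unset Printing Implicit Defensive.
Import Order.TTheory GRing.Theory Num.Theory.
Import numFieldNormedType.Exports.
Local Open Scope classical_set_scope.
Local Open Scope ring_scope.

(** * Fixed points, intermediate values, compactness and covering of intervals *)

Section RealLine.
Context {R : realType}.
Implicit Types (f g : R -> R) (a b c d t x y z : R).

(** The fixed points may form any closed set, with infinitely many complementary components, so no
    finite partition shows the chain. A point z is paired instead with the end p of its component
    from which it moves away. By Coppel's lemma the interval between p and z covers itself, so its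
    forward images increase, and the next fixed point p' must be found in their union, beyond z.
    [settled] ensures that the rest of the orbit does not linger near p. The delicate case is a
    falling orbit whose next fixed point upwards lies just beyond what has been reached;
    [preimage_near] then shows that it is reached after all.

    The required spacing of clusters must be the same for all orbits, since it enters the constant
    of the O(n^k) bound. Each such uniform time comes from a contradiction with
    [small_jump_uniform]: without the wanted source, the orbit would keep a definite distance from
    all fixed points up to that time. *)

Lemma continuous_eps f x (e : R) : continuous f -> 0 < e ->
  exists2 r : R, 0 < r & forall y, `|y - x| < r -> `|f y - f x| < e.
Proof.
move=> cf e0; have /cvgrPdist_lt /(_ e e0) := cf x.
move=> /nbhs_ballP[r /= r0 H]; exists r => // y yx.
by rewrite distrC; apply: H; rewrite /ball /= distrC.
Qed.

Lemma continuous_iter f n : continuous f -> continuous (iter n f).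
Proof.
move=> cf; elim: n => [|n IH] x /=; first exact: cvg_id.
by apply: (@continuous_comp _ _ _ (iter n f) f) => //; [exact: IH | exact: cf].
Qed.

Lemma ivt f a b v : continuous f -> a <= b ->
  f a <= v <= f b \/ f b <= v <= f a -> exists2 c, a <= c <= b & f c = v.
Proof.
move=> cf ab H.
have [||c] := @IVT R f a b v ab.
- exact: continuous_subspaceT.
- rewrite ge_min le_max.
  by case: H => /andP[-> ->]; rewrite ?orbT.
- by rewrite in_itv /=; exists c.
Qed.

Lemma fixpoint_between f a b : continuous f -> a <= b ->
  (f a <= a /\ b <= f b) \/ (a <= f a /\ f b <= b) ->
  exists2 c, a <= c <= b & f c = c.
Proof.
move=> cf ab H.
have [||c acb E] := @ivt (fun x => f x - x) a b 0 _ ab.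
- by move=> x; apply: continuousB; [exact: cf|exact: cvg_id].
- by case: H => -[? ?]; [left|right]; apply/andP; split; lra.
- by exists c => //; lra.
Qed.

Lemma last_fixpoint f a x : continuous f -> f a = a -> a <= x ->
  exists p, [/\ f p = p, a <= p <= x & forall t, p < t <= x -> f t != t].
Proof.
move=> cf fa ax.
pose A := [set t | f t = t /\ t <= x].
have supA : has_sup A.
  by split; [exists a|exists x => t []].
have ubA t : A t -> t <= sup A by move=> At; apply: ub_le_sup => //; case: supA.
have lex : sup A <= x by apply: ge_sup => [|t []//]; exists a.
exists (sup A); split; last 2 first.
- by rewrite ubA.
- move=> t /andP[st tx]; apply/eqP => ft.
  by have := ubA t (conj ft tx); lra.
apply: contrapT => /eqP nf.
have e0 : 0 < `|f (sup A) - sup A| / 2 by rewrite divr_gt0// normr_gt0 subr_eq0.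
have [r r0 H] := continuous_eps (sup A) cf e0.
set e := _ / 2 in e0 H.
have m0 : 0 < Num.min r e by rewrite lt_min r0.
have [t At st] := sup_adherent m0 supA.
have ts := ubA t At.
have mr : Num.min r e <= r by rewrite ge_min lexx.
have me : Num.min r e <= e by rewrite ge_min lexx orbT.
have /H : `|t - sup A| < r by rewrite ltr_norml; apply/andP; split; lra.
case: At => -> _.
have : `|f (sup A) - sup A| = e * 2 by rewrite /e; lra.
move: st; case: (ltgtP (f (sup A) - sup A) 0) => [h|h|]; last by move/eqP; rewrite subr_eq0 (negbTE nf).
- rewrite (ltr0_norm h) ltr_norml; lra.
- rewrite (gtr0_norm h) ltr_norml; lra.
Qed.

Definition mirror f : R -> R := fun x => 1 - f (1 - x).

Lemma mirror_cont f : continuous f -> continuous (mirror f).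
Proof.
move=> cf x; apply: continuousB; first exact: cvg_cst.
apply: (@continuous_comp _ _ _ (fun x => 1 - x) f); last exact: cf.
by apply: continuousB; [exact: cvg_cst|exact: cvg_id].
Qed.

Lemma iter_mirror f n x : iter n (mirror f) x = 1 - iter n f (1 - x).
Proof.
elim: n => [|n IH] /=; first by rewrite subKr.
by rewrite IH /mirror subKr.
Qed.

Lemma mirrorK f : mirror (mirror f) = f.
Proof. by apply/funext => x; rewrite /mirror !subKr. Qed.

Lemma mirror_fix f x : mirror f x = x <-> f (1 - x) = 1 - x.
Proof. by rewrite /mirror; split => ?; lra. Qed.

Lemma first_fixpoint f x b : continuous f -> f b = b -> x <= b ->
  exists p, [/\ f p = p, x <= p <= b & forall t, x <= t < p -> f t != t].
Proof.
move=> cf fb xb.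
have [|||p [fp pb np]] := @last_fixpoint (mirror f) (1 - b) (1 - x).
- exact: mirror_cont.
- by rewrite /mirror subKr fb.
- lra.
exists (1 - p); split.
- exact/mirror_fix.
- by apply/andP; split; lra.
- move=> t xt; apply/eqP => ft.
  have /eqP[] : mirror f (1 - t) != 1 - t by apply: np; lra.
  by rewrite /mirror subKr ft.
Qed.

Lemma above_diag f a b x : continuous f -> (forall t, a <= t <= b -> f t != t) ->
  a <= x <= b -> x < f x -> forall t, a <= t <= b -> t < f t.
Proof.
move=> cf nf xab fx t tab; have := nf t tab.
rewrite neq_lt => /orP[ft|//]; exfalso.
have [xt|tx] := leP x t.
  have [|c cb fc] := fixpoint_between cf xt; first by right; split; lra.
  by move/eqP: fc; apply/negP/nf; lra.
have [|c cb fc] := fixpoint_between cf (ltW tx); first by left; split; lra.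
by move/eqP: fc; apply/negP/nf; lra.
Qed.

Lemma below_diag f a b x : continuous f -> (forall t, a <= t <= b -> f t != t) ->
  a <= x <= b -> f x < x -> forall t, a <= t <= b -> f t < t.
Proof.
move=> cf nf xab fx t tab.
suff : 1 - t < mirror f (1 - t) by rewrite /mirror subKr; lra.
apply: (@above_diag (mirror f) (1 - b) (1 - a) (1 - x)); rewrite /mirror ?subKr.
- exact: mirror_cont.
- move=> u ub; apply/eqP => fu; have /eqP[] : f (1 - u) != 1 - u by apply: nf; lra.
  by apply/mirror_fix.
- lra.
- lra.
- lra.
Qed.

(** Compactness of [0, 1] as a supremum argument. It turns a radius chosen at each point into one
    for all points, for any condition that gets weaker as the radius shrinks. *)
Lemma uniform_local (Q : R -> R -> Prop) :
  (forall r s y, 0 < s <= r -> Q r y -> Q s y) ->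
  (forall x, 0 <= x <= 1 -> exists2 r : R, 0 < r &
     forall y, 0 <= y <= 1 -> `|y - x| < r -> Q r y) ->
  exists2 r : R, 0 < r & forall y, 0 <= y <= 1 -> Q r y.
Proof.
move=> anti loc.
pose A := [set c : R | 0 <= c <= 1 /\
  exists2 r, 0 < r & forall y, 0 <= y <= c -> Q r y].
have A0 : A 0.
  split; first lra.
  have [|r r0 H] := loc 0; first lra.
  exists r => // y y0; apply: H; first lra.
  have -> : y = 0 by lra.
  by rewrite subrr normr0.
have supA : has_sup A by split; [exists 0|exists 1 => t []; lra].
have ubA t : A t -> t <= sup A by move=> At; apply: ub_le_sup => //; case: supA.
have s1 : sup A <= 1 by apply: ge_sup => [|t []]; [exists 0|lra].
have s0 := ubA _ A0.
have [|r r0 H] := loc (sup A); first lra.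
have [c [c01 [r' r'0 Hc]] sc] := sup_adherent r0 supA.
have m0 : 0 < Num.min r r' by rewrite lt_min r0.
have K d : 0 <= d <= 1 -> d < sup A + r -> A d.
  move=> d01 dr; split => //; exists (Num.min r r') => // y yd.
  have [yc|cy] := leP y c.
    by apply: anti (Hc y _); rewrite ?m0 ?ge_min ?lexx ?orbT//; lra.
  apply: anti (H y _ _); rewrite ?m0 ?ge_min ?lexx//; first lra.
  by rewrite ltr_norml; apply/andP; split; lra.
have [_ [q q0 Hq]] : A 1.
  apply: (K 1); first lra.
  rewrite ltNge; apply/negP => h.
  have /ubA : A (sup A + r / 2) by apply: K; lra.
  lra.
by exists q.
Qed.

Lemma unif_cont f (e : R) : continuous f -> 0 < e -> exists2 r : R, 0 < r &
  forall x y, 0 <= x <= 1 -> 0 <= y <= 1 -> `|y - x| < r -> `|f y - f x| < e.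
Proof.
move=> cf e0.
have [||r r0 H] := @uniform_local (fun r x => forall y, 0 <= y <= 1 -> `|y - x| < r -> `|f y - f x| < e).
- by move=> r s x sr H y y01 yx; apply: H => //; lra.
- move=> x x01; have [|r r0 H] := @continuous_eps f x (e / 2) cf; first lra.
  exists (r / 2); first lra.
  move=> y y01 yx z z01 zy.
  have := H y; have := H z; move: yx zy; rewrite !ltr_norml => *.
  lra.
by exists r => // x y x01 y01; apply: H.
Qed.

Definition covers g a b c d := forall y, c <= y <= d -> exists2 t, a <= t <= b & g t = y.

Lemma covers_ivt g a b c d s t : continuous g -> a <= s <= b -> a <= t <= b ->
  g s <= c -> d <= g t -> covers g a b c d.
Proof.
move=> cg sab tab gs gt y ycd.
have [st|ts] := leP s t.
  have [|u ust <-] := ivt cg st (v := y); first by left; lra.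
  by exists u => //; lra.
have [|u ust <-] := ivt cg (ltW ts) (v := y); first by right; lra.
by exists u => //; lra.
Qed.

Lemma covers_comp g h a b c d a' b' :
  covers g a b c d -> covers h c d a' b' -> covers (h \o g) a b a' b'.
Proof.
move=> Hg Hh y /Hh[u /Hg[t tab <-] <-]; by exists t.
Qed.

Lemma covers_sub g a b c d a' b' c' d' : a' <= a -> b <= b' -> c <= c' -> d' <= d ->
  covers g a b c d -> covers g a' b' c' d'.
Proof.
move=> aa bb cc dd H y ycd; have [|t tab <-] := H y; first lra.
by exists t => //; lra.
Qed.

Lemma covers_iterD f m n a b c d a' b' :
  covers (iter n f) a b c d -> covers (iter m f) c d a' b' ->
  covers (iter (m + n) f) a b a' b'.
Proof.
move=> H1 H2 y yab; have [t tab <-] := covers_comp H1 H2 yab.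
by exists t => //; rewrite iterD.
Qed.

Lemma covers_self_iter f n a b : covers f a b a b -> covers (iter n f) a b a b.
Proof.
move=> H; elim: n => [|n IH]; first by move=> y yab; exists y.
by rewrite -addn1; apply: covers_iterD IH; rewrite /= => y /H.
Qed.

End RealLine.

(** * Polynomial entropy as growth of separated lists *)

Section Entropy.
Context {R : realType}.
Implicit Types (f : R -> R) (s : seq R).

Definition separated f n (e : R) s := [/\ uniq s, forall x, x \in s -> 0 <= x <= 1 &
  forall x y, x \in s -> y \in s -> x != y ->
    exists2 i, (i < n)%N & e < `|iter i f x - iter i f y|].

Lemma dyn_separatedP f n (e : R) (S : {fset R}) : 0 <= e ->
  dyn_separated f n e [set` S] <-> separated f n e S.
Proof.
move=> e0; split=> [[S01 sepS]|[_ S01 sepS]].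
- split=> [|x xS|x y xS yS /eqP xy]; first exact: fset_uniq.
    by have := S01 x xS; rewrite /= in_itv.
  (* As [0 <= e], the default value 0 of the maximum cannot exceed e. *)
  have /bigmax_gtP[|[i _ H]] := sepS x y xS yS xy; first by rewrite ltNge e0.
  by exists i.
- split=> [x /= xS|x y /= xS yS /eqP xy]; first by rewrite in_itv /= S01.
  have [i ni H] := sepS x y xS yS xy.
  by apply/bigmax_gtP; right; exists (Ordinal ni).
Qed.

Lemma separated_leq f n m (e e' : R) s : (n <= m)%N -> e' <= e ->
  separated f n e s -> separated f m e' s.
Proof.
move=> nm ee [us s01 H]; split => // x y xs ys xy.
have [i ni h] := H x y xs ys xy.
by exists i; [exact: leq_trans nm|exact: le_lt_trans h].
Qed.

Lemma sep_ge f n (e : R) s : 0 <= e -> separated f n e s ->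
  ((size s)%:R%:E <= sep f n e)%E.
Proof.
move=> e0 sp; apply: ereal_sup_ubound.
exists [fset x in s]%fset.
  apply/dyn_separatedP => //; case: sp => us s01 H; split.
  - exact: fset_uniq.
  - by move=> x; rewrite in_fset; apply: s01.
  - by move=> x y; rewrite !in_fset; apply: H.
by rewrite card_fseq undup_id//; case: sp.
Qed.

Lemma sep_le f n (e : R) B : 0 <= e ->
  (forall s, separated f n e s -> (size s <= B)%N) -> (sep f n e <= B%:R%:E)%E.
Proof.
move=> e0 H; apply: ge_ereal_sup => _ [S /(dyn_separatedP _ _ _ e0) Ss <-].
by rewrite lee_fin ler_nat; exact: H Ss.
Qed.

Lemma sep_ge0 f n (e : R) : 0 <= e -> (0 <= sep f n e)%E.
Proof. by move=> e0; apply: (@sep_ge f n e [::]). Qed.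

Definition growth f (e : R) := limn_esup (fun n => (lne (sep f n e) / (ln n%:R)%:E)%E).

Lemma inve_ln_ge0 n : (0 <= ((ln n%:R : R)%:E)^-1)%E.
Proof.
rewrite inve_ge0 lee_fin; case: n => [|n]; first by rewrite ln0.
by rewrite ln_ge0 // ler1n.
Qed.

Lemma growth_ge f (e c : R) :
  (forall N, exists2 n, (N <= n)%N & (c%:E <= lne (sep f n e) / (ln n%:R)%:E)%E) ->
  (c%:E <= growth f e)%E.
Proof.
move=> H; apply: le_ereal_inf_tmp => _ [V [N _ NV] <-].
have [n Nn h] := H N.
by apply: (le_trans h); apply: ereal_sup_ubound; exists n => //; apply: NV.
Qed.

Lemma growth_le f (e c : R) N :
  (forall n, (N <= n)%N -> (lne (sep f n e) / (ln n%:R)%:E <= c%:E)%E) ->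
  (growth f e <= c%:E)%E.
Proof.
move=> H; apply: ge_ereal_inf.
exists (ereal_sup [set (lne (sep f n e) / (ln n%:R)%:E)%E | n in [set n | (N <= n)%N]]).
  by exists [set n | (N <= n)%N] => //; exists N.
by apply: ge_ereal_sup => _ [n /= Nn <-]; apply: H.
Qed.

Lemma growth_anti f (d e : R) : 0 <= d -> d <= e -> (growth f e <= growth f d)%E.
Proof.
move=> d0 de.
 apply: le_ereal_inf_tmp => _ [V V_oo <-].
apply: ge_ereal_inf; eexists; first by exists V.
apply: ge_ereal_sup => _ [n Vn <-].
apply: le_ereal_sup_tmp; eexists; first by exists n.
apply: lee_wpmul2r; first exact: inve_ln_ge0.
have e0 := le_trans d0 de.
rewrite lee_lne ?in_itv /= ?leey ?andbT; [|exact: sep_ge0|exact: sep_ge0].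
apply: ereal_sup_le => _ [S /(dyn_separatedP _ _ _ e0) SS <-]; exists S => //.
by apply/(dyn_separatedP _ _ _ d0); apply: separated_leq de SS.
Qed.

Lemma h_polE f : h_pol f = ereal_sup [set growth f e | e in `]0, +oo[].
Proof.
have H : {in `]0, +oo[ &, {homo growth f : d e / d <= e >-> (e <= d)%E}}.
  by move=> d e; rewrite !in_itv /= !andbT => /ltW d0 _; apply: growth_anti.
have b0 : (BRight (0 : R) < +oo)%O by [].
have := nonincreasing_at_right_cvge _ b0 H.
exact: cvg_lim.
Qed.

Lemma ln_unbounded (K : R) : exists N, forall n, (N <= n)%N -> K <= ln (n%:R : R).
Proof.
exists (Num.truncn (expR K)).+1 => n Nn.
have h : expR K <= n%:R.
  apply: ltW; apply: lt_le_trans (truncnS_gt _) _.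
  by rewrite ler_nat.
rewrite -(expRK K) ler_ln ?posrE ?expR_gt0 //.
exact: lt_le_trans (expR_gt0 _) h.
Qed.

(** The falling factorial [(k + j) ^_ k] is a product of k factors, all larger than j. *)
Lemma binomial_lower k j : (j ^ k <= 'C(k + j, k) * k`!)%N.
Proof.
rewrite bin_ffact; elim: k => [|k IH]; first by rewrite ffactn0.
rewrite addSn ffactnS expnS leq_mul //; lia.
Qed.

(** At [n = k + j] there are at least [j ^ k / k!] points, while the length m of the orbits is at
    most a constant times j; so the quotient of logarithms is at least k up to a term of order
    [1 / ln m]. *)
Lemma h_pol_ge f k (d : R) N : 0 < d -> (0 < N)%N ->
  (forall n, exists2 s, separated f (N * n).+1 d s & ('C(n, k) <= size s)%N) ->
  (k%:R%:E <= h_pol f)%E.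
Proof.
move=> d0 N0 H; rewrite h_polE.
apply: (@le_trans _ _ (growth f d)); last first.
  by apply: ereal_sup_ubound; exists d => //=; rewrite in_itv /= d0.
apply/lee_addgt0Pr => t t0; rewrite -leeBlDr // -EFinB.
apply: growth_ge => M.
(* For [j >= 1] this gives [N * (k + j) + 1 <= A * j]. The threshold J below makes the constants
   [k * ln A + ln k!] cost at most [t * ln j]. *)
pose A := ((N * k.+1).+1)%N.
have [J HJ] := ln_unbounded ((k%:R * ln A%:R + ln (k`!)%:R) / t).
pose j := (maxn 2 (maxn J M)).
have j2 : (2 <= j)%N by rewrite leq_maxl.
have jJ : (J <= j)%N by rewrite /j; lia.
have jM : (M <= j)%N by rewrite /j; lia.
have [s sp szs] := H (k + j)%N.
set m := (N * (k + j)).+1 in sp.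
have jm : (j <= m)%N by rewrite /m; nia.
have mA : (m <= A * j)%N by rewrite /m /A; nia.
exists m; first lia.
have j0 : 0 < j%:R :> R by rewrite ltr0n; lia.
have m0 : 0 < m%:R :> R by rewrite ltr0n.
have lm : 0 < ln m%:R :> R by rewrite ln_gt0 // ltr1n; lia.
rewrite inver gt_eqF // lee_pdivlMr // -EFinM.
have C0 : 0 < 'C(k + j, k)%:R :> R by rewrite ltr0n bin_gt0; lia.
apply: (@le_trans _ _ (ln 'C(k + j, k)%:R)%:E); last first.
  rewrite -lne_EFin // lee_lne ?in_itv /= ?leey ?andbT ?lee_fin ?sep_ge0 ?(ltW C0) ?(ltW d0) //.
  apply: le_trans (sep_ge (ltW d0) sp).
  by rewrite lee_fin ler_nat.
rewrite lee_fin.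
have h1 : k%:R * ln (j%:R : R) <= ln ('C(k + j, k))%:R + ln (k`!)%:R.
  rewrite -lnM ?posrE // ?ltr0n ?fact_gt0 // -natrM mulr_natl -lnXn // -natrX.
  rewrite ler_ln ?posrE ?ltr0n ?muln_gt0 ?fact_gt0 ?expn_gt0 ?bin_gt0 ?ler_nat ?binomial_lower //; lia.
have h2 : ln m%:R <= ln A%:R + ln j%:R :> R.
  rewrite -lnM ?posrE ?ltr0n // -?natrM; last lia.
  by rewrite ler_ln ?posrE ?ltr0n ?ler_nat // muln_gt0; lia.
have h3 : ln j%:R <= ln m%:R :> R by rewrite ler_ln ?posrE ?ler_nat.
have h4 := HJ j jJ.
rewrite ler_pdivrMr // in h4.
have h5 : k%:R * ln m%:R <= k%:R * (ln A%:R + ln j%:R) :> R by rewrite ler_wpM2l.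
nra.
Qed.

Definition poly_bound f k := forall e : R, 0 < e -> exists C, forall n s,
  (0 < n)%N -> separated f n e s -> (size s <= C * n ^ k)%N.

Lemma h_pol_le f k : poly_bound f k -> (h_pol f <= k%:R%:E)%E.
Proof.
move=> H; rewrite h_polE; apply: ge_ereal_sup => _ [e /= e0 <-].
rewrite in_itv /= andbT in e0.
have [C HC] := H e e0.
apply/lee_addgt0Pr => t t0; rewrite -EFinD.
have [J HJ] := ln_unbounded (ln C.+1%:R / t).
apply: (@growth_le _ _ _ (maxn 2 J)) => n.
rewrite geq_max => /andP[n2 /HJ Jn].
have n0 : 0 < n%:R :> R by rewrite ltr0n; lia.
have ln0 : 0 < ln n%:R :> R by rewrite ln_gt0 // ltr1n.
rewrite inver gt_eqF // lee_pdivrMr // -EFinM.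
rewrite ler_pdivrMr // in Jn.
have B0 : 0 < (C.+1 * n ^ k)%:R :> R by rewrite ltr0n muln_gt0 expn_gt0; lia.
apply: (@le_trans _ _ (ln (C.+1 * n ^ k)%:R)%:E).
  rewrite -lne_EFin // lee_lne ?in_itv /= ?leey ?andbT ?lee_fin ?sep_ge0 ?(ltW B0) ?(ltW e0) //.
  apply: sep_le (ltW e0) _ => s /HC Hs.
  by apply: leq_trans (Hs _) _; [lia|rewrite leq_mul2r leqnSn orbT].
rewrite lee_fin natrM lnM ?posrE ?ltr0n // ?expn_gt0; last lia.
by rewrite natrX lnXn // -[ln n%:R *+ k]mulr_natl; nra.
Qed.

Lemma eq_h_pol f g : (forall n x, 0 <= x <= 1 -> iter n f x = iter n g x) ->
  h_pol f = h_pol g.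
Proof.
move=> fg; rewrite !h_polE.
suff : forall e, `]0, +oo[%classic e -> growth f e = growth g e.
  by move: (growth f) (growth g) => ? ? E; rewrite (eq_imagel E).
move=> e.
rewrite /= in_itv /= andbT => /ltW e0.
congr (limn_esup _); apply/funext => n; congr (lne _ / _)%E.
congr ereal_sup; congr image; apply/funext => S; apply/propext.
split=> /(dyn_separatedP _ _ _ e0)[us s01 H]; apply/(dyn_separatedP _ _ _ e0).
- split => // x y xs ys xy; rewrite -?fg; have [i ni] := H x y xs ys xy.
  by rewrite !fg; [exists i|exact: s01|exact: s01].
- split => // x y xs ys xy; have [i ni] := H x y xs ys xy.
  by rewrite -!fg; [exists i|exact: s01|exact: s01].
Qed.

End Entropy.

(** * One-way horseshoes *)

Section Chains.
Context {R : realType}.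
Implicit Types (f g : R -> R) (s : seq R) (a b c d : R).

(* A chain of length k starting at [a, b]: only consecutive intervals have to be
   disjoint, and nothing is required of the last one. Distant intervals of a
   chain may overlap or coincide. *)
Fixpoint chain g k a b : Prop :=
  0 <= a /\ a <= b /\ b <= 1 /\
  if k is k'.+1 then covers g a b a b /\
    exists c d, [/\ covers g a b c d, b < c \/ d < a & chain g k' c d]
  else True.

Definition has_chain f k := exists2 N, (0 < N)%N & exists a b, chain (iter N f) k a b.

Lemma chain_bounds g k a b : chain g k a b -> [/\ 0 <= a, a <= b & b <= 1].
Proof. by case: k => [|k] [? [? [? _]]]. Qed.

Lemma iter_iter f m n x : iter n (iter m f) x = iter (n * m) f x.
Proof. by elim: n => [//|n IH]; rewrite iterS IH mulSn iterD. Qed.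

(** Self-covering lets an orbit wait [m - 1] steps in an interval before the one step that moves
    on. *)
Lemma chain_iter g k m a b : (0 < m)%N -> chain g k a b -> chain (iter m g) k a b.
Proof.
move=> m0; elim: k a b => [//|k IH] a b /= [a0 [ab [b1 [cab [c [d [ccd dis /IH Hc]]]]]]].
do !split => //; first exact: covers_self_iter.
exists c, d; split => //.
case: m m0 {IH Hc} => // m _; rewrite -addn1 addnC.
by apply: covers_iterD (covers_self_iter _ cab) _; rewrite /= => y /ccd.
Qed.

Lemma chain_iterM f k N m a b : (0 < m)%N -> chain (iter N f) k a b ->
  chain (iter (m * N) f) k a b.
Proof.
move=> m0 /(chain_iter m0); congr (chain _ _ _ _).
by apply/funext => x; rewrite iter_iter.
Qed.

Lemma has_chainW f k : has_chain f k.+1 -> has_chain f k.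
Proof.
by move=> [N N0 [a [b [_ [_ [_ [_ [c [d [_ _ H]]]]]]]]]]; exists N => //; exists c, d.
Qed.

Lemma has_chain_le f k l : (k <= l)%N -> has_chain f l -> has_chain f k.
Proof.
elim: l => [|l IH]; first by rewrite leqn0 => /eqP->.
by rewrite leq_eqVlt => /predU1P[->//|kl /has_chainW /IH]; apply.
Qed.

Lemma has_chain_iter f m k : (0 < m)%N -> has_chain (iter m f) k -> has_chain f k.
Proof.
move=> m0 [N N0 [a [b H]]]; exists (N * m)%N; first by rewrite muln_gt0 N0.
exists a, b; move: H; congr (chain _ _ _ _).
by apply/funext => x; rewrite iter_iter.
Qed.

(* The separated set S(n, k) is made of preimages, in the first interval, of
   the points of S(n - 1, k) (which stay there) and of those of S(n - 1, k - 1)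
   for the rest of the chain (which move on): its size obeys Pascal's rule. *)
Lemma chain_separated g k a b : chain g k a b ->
  exists2 e : R, 0 < e & forall n, exists s, [/\ forall x, x \in s -> a <= x <= b,
    separated g n.+1 e s & ('C(n, k) <= size s)%N].
Proof.
elim: k a b => [|k IH] a b.
  move=> [a0 [ab [b1 _]]]; exists 1 => // n; exists [:: a].
  split; rewrite ?bin0 //; first by move=> x /[!inE] /eqP ->; lra.
  split => // [x /[!inE]/eqP->|x y /[!inE] /eqP -> /eqP ->]; first lra.
  by rewrite eqxx.
move=> [a0 [ab [b1 [cab [c [d [ccd dis /[dup] /chain_bounds[c0 cd d1] Hc]]]]]]].
have [e e0 He] := IH _ _ Hc.
pose e1 := Num.min e (Num.max (c - b) (a - d) / 2).
have D0 : 0 < Num.max (c - b) (a - d) by rewrite lt_max; case: dis => h; apply/orP; [left|right]; lra.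
have e10 : 0 < e1 by rewrite lt_min e0 /= divr_gt0.
have e1e : e1 <= e by rewrite ge_min lexx.
have far x y : a <= x <= b -> c <= y <= d -> e1 < `|x - y|.
  move=> xab ycd; apply: (@le_lt_trans _ _ (Num.max (c - b) (a - d) / 2)).
    by rewrite ge_min lexx orbT.
  have : Num.max (c - b) (a - d) / 2 < Num.max (c - b) (a - d) by lra.
  move/lt_le_trans; apply; rewrite ge_max !ler_normr; apply/andP; split; apply/orP;
  [right|left]; lra.
exists e1 => //; elim=> [|n [s [sab [us s01 ss] szs]]].
  by exists [::]; split.
have [t [tcd [ut t01 st] szt]] := He n.
have /choice[h Hh] : forall y, exists x, (a <= y <= b) || (c <= y <= d) -> a <= x <= b /\ g x = y.
  move=> y; have [/orP[/cab|/ccd] [x xab gx]|] := boolP ((a <= y <= b) || (c <= y <= d)).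
  - by exists x.
  - by exists x.
  - by exists 0.
have Hs x : x \in s ++ t -> (a <= x <= b) || (c <= x <= d).
  by rewrite mem_cat => /orP[/sab ->//|/tcd ->]; rewrite orbT.
have ust : uniq (s ++ t).
  rewrite cat_uniq us ut andbT /=; apply/hasPn => x /tcd xcd; apply/negP => /sab xab.
  by have := far x x xab xcd; rewrite subrr normr0; lra.
exists [seq h x | x <- s ++ t]; split.
- by move=> _ /mapP[x /Hs /Hh [] hx _ ->].
- split.
  + rewrite map_inj_in_uniq // => x y /Hs /Hh[_ gx] /Hs /Hh[_ gy] E.
    by rewrite -gx -gy E.
  + by move=> _ /mapP[x /Hs /Hh [] hx _ ->]; lra.
  + move=> _ _ /mapP[x xst ->] /mapP[y yst ->] hxy.
    have [_ gx] := Hh x (Hs _ xst); have [_ gy] := Hh y (Hs _ yst).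
    have xy : x != y by apply: contraNneq hxy => ->.
    suff [i ni H] : exists2 i, (i < n.+1)%N & e1 < `|iter i g x - iter i g y|.
      by exists i.+1 => //; rewrite !iterSr gx gy.
    move: xst yst; rewrite !mem_cat => /orP[xs|xt] /orP[ys|yt].
    * exact: ss.
    * by exists 0%N => //=; apply: far; [exact: sab|exact: tcd].
    * by exists 0%N => //=; rewrite distrC; apply: far; [exact: sab|exact: tcd].
    * by have [i ni H] := st x y xt yt xy; exists i => //; apply: le_lt_trans H.
- by rewrite size_map size_cat binS leq_add.
Qed.

Lemma separated_iter f N n (e : R) s : (0 < N)%N ->
  separated (iter N f) n.+1 e s -> separated f (N * n).+1 e s.
Proof.
move=> N0 [us s01 H]; split => // x y xs ys xy.
have [i ni h] := H x y xs ys xy.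
exists (i * N)%N; first by rewrite ltnS mulnC leq_mul.
by rewrite -!iter_iter.
Qed.

Lemma has_chain_h_pol f k : has_chain f k -> (k%:R%:E <= h_pol f)%E.
Proof.
move=> [N N0 [a [b /chain_separated[e e0 H]]]].
apply: (h_pol_ge e0 N0) => n; have [s [_ sp szs]] := H n.
by exists s => //; apply: separated_iter.
Qed.

End Chains.

(** * Maps all of whose periodic points are fixed *)

Section Coppel.
Context {R : realType}.
Implicit Types (f g : R -> R) (p q t x y z : R).

Definition aperiodic f := [/\ continuous f, forall x, 0 <= f x <= 1 &
  forall x m, (0 < m)%N -> iter m f x = x -> f x = x].

Lemma mirror_aperiodic f : aperiodic f -> aperiodic (mirror f).
Proof.
move=> [cf fr fp]; split; first exact: mirror_cont.
- by move=> x; rewrite /mirror; have := fr (1 - x); lra.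
- move=> x m m0; rewrite iter_mirror => h; apply/mirror_fix; apply: (fp _ m) => //.
  lra.
Qed.

Lemma orbit01 f x n : aperiodic f -> 0 <= x <= 1 -> 0 <= iter n f x <= 1.
Proof. by case=> _ fr _; case: n => [//|n] _; apply: fr. Qed.

Lemma iter_fix f n x : f x = x -> iter n f x = x.
Proof. by move=> fx; elim: n => [//|n IH]; rewrite iterS IH. Qed.

Lemma near_fixpoint f a x n : continuous f -> f a = a -> a < x ->
  exists2 r : R, 0 < r & forall t, `|t - a| < r -> forall i, (i <= n)%N -> iter i f t < x.
Proof.
move=> cf fa ax; elim: n => [|n [r r0 H]].
  exists (x - a) => [|t h i]; first lra.
  by rewrite leqn0 => /eqP -> /=; move: h; rewrite ltr_norml; lra.
have [|r' r'0 H'] := @continuous_eps _ _ a (x - a) (@continuous_iter _ _ n.+1 cf); first lra.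
exists (Num.min r r') => [|t]; first by rewrite lt_min r0.
rewrite lt_min => /andP[tr /H' h] i; rewrite leq_eqVlt => /predU1P[->|]; last exact: H.
by move: h; rewrite (iter_fix _ fa) ltr_norml; lra.
Qed.

(* Otherwise f^(n+1) is below the diagonal all the way from x down to the first
   fixed point, near which points move up n+1 times in a row. *)
Lemma coppel f x n : aperiodic f -> x < f x -> x < iter n.+1 f x.
Proof.
move=> [cf fr fp] fx; rewrite ltNge le_eqVlt; apply/negP => /predU1P[gx|gx].
  by have := fp _ _ _ gx; rewrite ltn0Sn; move=> /(_ isT); lra.
set g := iter n.+1 f in gx.
have cg : continuous g by apply: continuous_iter.
have gf t : g t = t -> f t = t by apply: fp.
have fr' : 0 <= g x by have := fr (iter n f x); rewrite /g iterS; lra.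
(* The values of g lie in [0, 1], so g is above the diagonal at -1 and has a fixed point to the left
   of x. *)
have [||c cx /gf fc] := @fixpoint_between _ g (- 1) x cg; first lra.
  by right; split; [have := fr (iter n f (-1)); rewrite /g iterS; lra|exact: ltW].
have [|a [fa cax na]] := last_fixpoint cf fc (_ : c <= x); first lra.
have ax : a < x.
  by rewrite lt_neqAle; apply/andP; split; last lra; apply/eqP => E; move: fx; rewrite -E fa ltxx.
have up t : a < t <= x -> t < f t.
  move=> tax; apply: (@above_diag _ f t x x) => //; try lra.
  by move=> u ut; apply: na; lra.
have dn t : a < t <= x -> g t < t.
  move=> tax; apply: (@below_diag _ g t x x) => //; try lra.
  by move=> u ut; apply/eqP => /gf /eqP; apply/negP/na; lra.
have [r r0 Hr] := near_fixpoint n.+1 cf fa ax.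
pose t := a + Num.min (r / 2) (x - a).
have m0 : 0 < Num.min (r / 2) (x - a) by rewrite lt_min; lra.
have mr : Num.min (r / 2) (x - a) <= r / 2 by rewrite ge_min lexx.
have mx : Num.min (r / 2) (x - a) <= x - a by rewrite ge_min lexx orbT.
have {Hr} Hr := Hr t _.
have ta : `|t - a| < r by rewrite /t ltr_norml; lra.
have inc i : (i <= n.+1)%N -> t <= iter i f t.
  elim: i => [//|i IH] ni; have {}IH := IH (ltnW ni).
  have := up (iter i f t); have := Hr ta i (ltnW ni); rewrite iterS /t.
  move: IH; rewrite /t; lra.
by have := inc n.+1 (leqnn _); have := dn t; rewrite /g /t; lra.
Qed.

Lemma coppel_down f x n : aperiodic f -> f x < x -> iter n.+1 f x < x.
Proof.
move=> /mirror_aperiodic tf fx.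
have := @coppel _ (1 - x) n tf; rewrite iter_mirror /mirror subKr; lra.
Qed.

Lemma coppel_le f x m n : aperiodic f -> (m < n)%N ->
  iter m f x < f (iter m f x) -> iter m f x < iter n f x.
Proof.
move=> tf mn /(coppel (n - m).-1 tf).
by rewrite -iterD; have -> : ((n - m).-1.+1 + m = n)%N by lia.
Qed.

Lemma coppel_ge f x m n : aperiodic f -> (m < n)%N ->
  f (iter m f x) < iter m f x -> iter n f x < iter m f x.
Proof.
move=> tf mn /(coppel_down (n - m).-1 tf).
by rewrite -iterD; have -> : ((n - m).-1.+1 + m = n)%N by lia.
Qed.

Lemma infinitely_many_switches (P : nat -> Prop) :
  (forall m, exists2 i, (m <= i)%N & P i) -> (forall m, exists2 i, (m <= i)%N & ~ P i) ->
  forall m, exists2 i, (m <= i)%N & P i /\ ~ P i.+1.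
Proof.
move=> infP infN m; apply: contrapT => no.
have [i mi Pi] := infP m.
have all j : P (i + j)%N.
  elim: j => [|j IH]; first by rewrite addn0.
  apply: contrapT => nP; apply: no; exists (i + j)%N; first lia.
  by rewrite -addnS.
have [j ij []] := infN i.
by have := all (j - i)%N; rewrite subnKC.
Qed.

Lemma eventually_up (u : nat -> R) (e : R) m : 0 < e ->
  (forall n, (m <= n)%N -> u n + e <= u n.+1) -> (forall n, u n.+1 <= 1) -> False.
Proof.
move=> e0 H b.
have K n : u m + n%:R * e <= u (m + n)%N.
  elim: n => [|n IH]; first by rewrite mul0r addr0 addn0.
  rewrite addnS; apply: le_trans (H _ _); last exact: leq_addr.
  by rewrite -natr1; lra.
pose n := (Num.truncn ((1 - u m) / e)).+1.
have : (1 - u m) / e < n%:R by apply: truncnS_gt.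
rewrite ltr_pdivrMr // => h.
have := K n; rewrite /n addnS; have := b (m + Num.truncn ((1 - u m) / e))%N.
rewrite -/n; lra.
Qed.

(* The points of an orbit moving up increase to al, those moving down decrease
   to be; if both kinds occur infinitely often then f exchanges al and be,
   so al = be. *)
Lemma small_jump f (e : R) z : aperiodic f -> 0 < e ->
  exists i, `|f (iter i f z) - iter i f z| < e.
Proof.
move=> tf e0; have [cf fr fp] := tf.
apply: contrapT => no.
have J i : e <= `|f (iter i f z) - iter i f z|.
  by rewrite leNgt; apply/negP => h; apply: no; exists i.
pose u i := iter i f z.
pose P i := u i < u i.+1.
have up i : P i -> u i + e <= u i.+1.
  by move=> Pi; have := J i; rewrite gtr0_norm ?subr_gt0 //; rewrite /u /=; lra.
have dn i : ~ P i -> u i.+1 + e <= u i.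
  move=> /negP; rewrite -leNgt => h; have := J i.
  by rewrite ler0_norm ?subr_le0 //; rewrite /u /=; lra.
have upl i j : P i -> (i < j)%N -> u i < u j by move=> Pi ij; apply: coppel_le.
have dnl i j : ~ P i -> (i < j)%N -> u j < u i.
  move=> /dn h ij; apply: coppel_ge => //; move: h; rewrite /u /=; lra.
have infP m : exists2 i, (m <= i)%N & P i.
  apply: contrapT => h; apply: (@eventually_up (fun i => 1 - u i) e m) => // n.
    move=> mn; suff /dn : ~ P n by lra.
    by move=> Pn; apply: h; exists n.
  by have := fr (u n); rewrite /u /=; lra.
have infN m : exists2 i, (m <= i)%N & ~ P i.
  apply: contrapT => h; apply: (@eventually_up u e m) => // n.
    move=> mn; suff /up : P n by lra.
    by apply: contrapT => Pn; apply: h; exists n.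
  by have := fr (u n); rewrite /u /=; lra.
have cross i j : P i -> ~ P j -> u i < u j.
  move=> Pi Pj; have [ij|ji|E] := ltngtP i j; [exact: upl|exact: dnl|].
  by rewrite E in Pi.
pose U := [set u i | i in P]; pose D := [set u i | i in ~` P].
have [i0 _ Pi0] := infP 0%N; have [j0 _ Nj0] := infN 0%N.
have sU : has_sup U.
  split; first by exists (u i0), i0.
  by exists (u j0) => _ [i Pi <-]; apply/ltW/cross.
have iD : has_inf D.
  split; first by exists (u j0), j0.
  by exists (u i0) => _ [i Pi <-]; apply/ltW/cross.
set al := sup U; set be := inf D.
have leU i : P i -> u i <= al by move=> Pi; apply: ub_le_sup; [case: sU|exists i].
have geD i : ~ P i -> be <= u i by move=> Pi; apply: ge_inf; [case: iD|exists i].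
have close (r : R) : 0 < r -> exists m, forall i, (m <= i)%N ->
    (P i -> al - r < u i) /\ (~ P i -> u i < be + r).
  move=> r0.
  have [_ [i Pi <-] hi] := sup_adherent r0 sU.
  have [_ [j Pj <-] hj] := inf_adherent r0 iD.
  exists (maxn i j).+1 => n nij; split => Pn.
    by have := @upl i n Pi (_ : (i < n)%N); rewrite -/al in hi; move=> /(_ (leq_trans (leq_ltn_trans (leq_maxl _ _) (ltnSn _)) nij)); lra.
  by have := @dnl j n Pj; rewrite -/be in hj; move=> /(_ (leq_trans (leq_ltn_trans (leq_maxr _ _) (ltnSn _)) nij)); lra.
have trans_up (r : R) : 0 < r -> exists i, [/\ al - r < u i, u i <= al, be <= u i.+1 & u i.+1 < be + r].
  move=> /close[m Hm]; have [i mi [Pi Ni]] := infinitely_many_switches infP infN m.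
  exists i; have [h _] := Hm i mi; have [_ h'] := Hm i.+1 (leqW mi).
  by split; auto.
have trans_dn (r : R) : 0 < r -> exists i, [/\ be <= u i, u i < be + r, al - r < u i.+1 & u i.+1 <= al].
  move=> /close[m Hm].
  have infNN k : exists2 i, (k <= i)%N & ~ ~ P i by have [i ki Pi] := infP k; exists i.
  have [i mi [Ni /contrapT Pi]] := infinitely_many_switches infN infNN m.
  exists i; have [_ h'] := Hm i mi; have [h _] := Hm i.+1 (leqW mi).
  by split; auto.
have fab : f al = be.
  apply: contrapT => /eqP ne.
  have d0 : 0 < `|f al - be| / 2 by rewrite divr_gt0 // normr_gt0 subr_eq0.
  have [r r0 Hr] := continuous_eps al cf d0.
  have [|i [h1 h2 h3 h4]] := trans_up (Num.min r (`|f al - be| / 2)); first by rewrite lt_min r0.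
  have mr : Num.min r (`|f al - be| / 2) <= r by rewrite ge_min lexx.
  have mr' : Num.min r (`|f al - be| / 2) <= `|f al - be| / 2 by rewrite ge_min lexx orbT.
  have /Hr : `|u i - al| < r by rewrite ltr_norml; lra.
  rewrite ltr_norml -[f (u i)]/(u i.+1) => h.
  have : `|f al - be| < `|f al - be| by rewrite {1}ltr_norml; lra.
  by rewrite ltxx.
have fba : f be = al.
  apply: contrapT => /eqP ne.
  have d0 : 0 < `|f be - al| / 2 by rewrite divr_gt0 // normr_gt0 subr_eq0.
  have [r r0 Hr] := continuous_eps be cf d0.
  have [|i [h1 h2 h3 h4]] := trans_dn (Num.min r (`|f be - al| / 2)); first by rewrite lt_min r0.
  have mr : Num.min r (`|f be - al| / 2) <= r by rewrite ge_min lexx.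
  have mr' : Num.min r (`|f be - al| / 2) <= `|f be - al| / 2 by rewrite ge_min lexx orbT.
  have /Hr : `|u i - be| < r by rewrite ltr_norml; lra.
  rewrite ltr_norml -[f (u i)]/(u i.+1) => h.
  have : `|f be - al| < `|f be - al| by rewrite {1}ltr_norml; lra.
  by rewrite ltxx.
have E : f al = al by apply: (fp al 2%N) => //=; rewrite fab fba.
have e2 : 0 < e / 2 by lra.
have [i [h1 h2 h3 h4]] := trans_up _ e2.
by have := J i; rewrite -/(u i) -[f (u i)]/(u i.+1) leNgt ltr_norml; lra.
Qed.

End Coppel.

(** * Estimates uniform over all points of [0, 1] *)

Section UniformEstimates.
Context {R : realType}.
Implicit Types (f g : R -> R) (b p q t w x y z : R).

Lemma small_jump_uniform f (e : R) : aperiodic f -> 0 < e -> exists L, forall z,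
  0 <= z <= 1 -> exists2 i, (i <= L)%N & `|f (iter i f z) - iter i f z| < e.
Proof.
move=> tf e0; have [cf _ _] := tf.
(* The bound on the time is written [i * r <= 1], which gets weaker as r decreases, as
   [uniform_local] demands. *)
have [||r r0 H] := @uniform_local R (fun r y => exists i : nat, i%:R * r <= 1 /\ `|f (iter i f y) - iter i f y| < e).
- move=> r s y /andP[s0 sr] [i [ir h]]; exists i; split => //.
  by apply: le_trans ir; rewrite ler_wpM2l.
- move=> x x01; have [i hi] := small_jump x tf e0.
  pose g y := `|f (iter i f y) - iter i f y|.
  have cg : continuous g.
    move=> y; apply: (@continuous_comp _ _ _ (fun y => f (iter i f y) - iter i f y) Num.norm).
      by apply: continuousB; [exact: (@continuous_iter _ _ i.+1 cf)|exact: continuous_iter].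
    exact: norm_continuous.
  have [|r r0 H] := @continuous_eps _ g x (e - g x) cg; first by rewrite subr_gt0.
  exists (Num.min r (i.+1%:R)^-1) => [|y _ yx]; first by rewrite lt_min r0 invr_gt0 ltr0n.
  exists i; split.
    apply: (@le_trans _ _ (i%:R * (i.+1%:R)^-1)).
      by rewrite ler_wpM2l // ge_min lexx orbT.
    by rewrite ler_pdivrMr ?ltr0n // mul1r ler_nat.
  rewrite -/(g y); have /H : `|y - x| < r by move: yx; rewrite lt_min => /andP[].
  by rewrite ltr_norml; lra.
- exists (Num.truncn r^-1).+1 => z /H[i [ir h]]; exists i => //.
  have : i%:R <= r^-1 by rewrite -[r^-1]mul1r ler_pdivlMr.
  by move=> /le_lt_trans /(_ (truncnS_gt _)); rewrite ltr_nat => /ltnW.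
Qed.

(** Near a fixed point the premise on v fails, and near any other point the displacement keeps half
    of its size. *)
Lemma far_from_fixpoints f (e : R) : continuous f -> 0 < e ->
  exists2 r : R, 0 < r & forall v, 0 <= v <= 1 ->
    (forall q, f q = q -> e <= `|q - v|) -> r <= `|f v - v|.
Proof.
move=> cf e0; apply: uniform_local => [r s y /andP[_ sr] H /H|x _].
  exact: le_trans.
have [fx|/eqP nx] := pselect (f x = x).
  exists e => // y _ yx H; have := H x fx; rewrite distrC; lra.
have d0 : 0 < `|f x - x| by rewrite normr_gt0 subr_eq0.
have cg : continuous (fun y => f y - y).
  by move=> y; apply: continuousB; [exact: cf|exact: cvg_id].
have [|r r0 H] := @continuous_eps _ _ x (`|f x - x| / 2) cg; first lra.
exists (Num.min r (`|f x - x| / 2)) => [|y _ yx _]; first by rewrite lt_min r0; lra.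
have /H h : `|y - x| < r by move: yx; rewrite lt_min => /andP[].
apply: (@le_trans _ _ (`|f x - x| / 2)); first by rewrite ge_min lexx orbT.
have := ler_distD (f y - y) (f x - x) 0; rewrite !subr0 [X in _ <= X + _]distrC.
lra.
Qed.

Lemma jump_far f (e : R) : continuous f -> 0 < e -> (forall x, 0 <= f x <= 1) ->
  exists2 r : R, 0 < r & forall w, 0 <= w <= 1 -> e <= `|f w - w| ->
    forall q, f q = q -> r <= `|q - w|.
Proof.
move=> cf e0 fr; have [|r r0 H] := @unif_cont _ f (e / 2) cf; first lra.
exists (Num.min r (e / 2)) => [|w w01 fw q fq]; first by rewrite lt_min r0; lra.
rewrite leNgt; apply/negP; rewrite lt_min => /andP[qr qe].
have q01 : 0 <= q <= 1 by rewrite -fq.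
have := H w q w01 q01 qr; rewrite fq => h.
have := ler_distD q (f w) w; rewrite [X in _ <= X + _]distrC; lra.
Qed.

(** Both points lie in one component of the complement of the fixed points; [min] and [max] avoid
    fixing their order. *)
Definition fixfree f x y := forall t, Num.min x y <= t <= Num.max x y -> f t != t.

Lemma fixfree_le f x y : x <= y -> fixfree f x y <-> forall t, x <= t <= y -> f t != t.
Proof. by move=> xy; rewrite /fixfree (min_idPl xy) (max_idPr xy). Qed.

Lemma fixfreeC f x y : fixfree f x y <-> fixfree f y x.
Proof. by rewrite /fixfree minC maxC. Qed.

(* If b is the fixed point next above f w and lies close to f w, then b itself
   is the image of a point not separated from w by fixed points. *)
Lemma preimage_near f (e : R) : continuous f -> 0 < e -> exists2 r : R, 0 < r &
  forall w, 0 <= w <= 1 -> e <= `|f w - w| -> f (f w) <> f w -> forall b, f b = b ->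
    f w < b < f w + r -> (forall t, f w <= t < b -> f t != t) ->
    exists2 w', f w' = b & fixfree f w w'.
Proof.
move=> cf e0; apply: uniform_local => [r s y sr H fy ffy b fb fwb nb|x x01].
  by apply: H => //; lra.
have [fx|fx] := ltP `|f x - x| e.
  have cg : continuous (fun y => f y - y).
    by move=> y; apply: continuousB; [exact: cf|exact: cvg_id].
  have [|r r0 H] := @continuous_eps _ _ x (e - `|f x - x|) cg; first lra.
  exists r => // y _ /H h fy; exfalso.
  have := ler_distD (f x - x) (f y - y) 0; rewrite !subr0; lra.
have nx : f x != x by rewrite -subr_eq0 -normr_gt0; lra.
have cg : continuous (fun y => f y - y).
  by move=> y; apply: continuousB; [exact: cf|exact: cvg_id].
have [r r0 Hr] := continuous_eps x cg (lt_le_trans e0 fx).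
have free t : x - r / 2 <= t <= x + r / 2 -> f t != t.
  move=> tx; apply/eqP => ft.
  have /Hr : `|t - x| < r by rewrite ltr_norml; lra.
  by rewrite ft subrr sub0r normrN ltxx.
(* The maximum [f c] over a neighbourhood free of fixed points bounds how high images reach. Either
   [f c] is fixed, and the first fixed point b above [f w] cannot lie beyond it, or fixed points
   keep away from [f c], and b, being close to [f w <= f c], cannot lie beyond it either. *)
have [||c /[!in_itv] /= cx Hc] := @EVT_max _ f (x - r / 2) (x + r / 2); first lra.
  exact: continuous_subspaceT.
have hit w b : `|w - x| < r / 2 -> f w <= b <= f c -> exists2 w', f w' = b & fixfree f w w'.
  rewrite ltr_norml => wx bc.
  have [wc|cw] := leP w c.
    have [|w' ww' <-] := ivt cf wc (v := b); first by left.
    exists w' => //; apply/fixfree_le; first lra.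
    by move=> t tw; apply: free; lra.
  have [|w' ww' <-] := ivt cf (ltW cw) (v := b); first by right.
  exists w' => //; apply/fixfreeC/fixfree_le; first lra.
  by move=> t tw; apply: free; lra.
have [fmu|/eqP nmu] := pselect (f (f c) = f c).
  exists (r / 2) => [|w _ wx _ ffw b fb bw nb]; first lra.
  apply: hit => //; rewrite leNgt; apply/andP; split; first by rewrite -leNgt; lra.
  have fwc : f w <= f c by apply: Hc; rewrite in_itv /=; move: wx; rewrite ltr_norml; lra.
  by apply/negP => h; move/eqP: fmu; apply/negP/nb; lra.
have d0 : 0 < `|f (f c) - f c| by rewrite normr_gt0 subr_eq0.
have [r1 r10 Hr1] := continuous_eps (f c) cg d0.
exists (Num.min (r / 2) r1) => [|w _]; first by rewrite lt_min r10; lra.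
rewrite lt_min => /andP[wx wr1] _ ffw b fb bw nb.
apply: hit => //; rewrite leNgt; apply/andP; split; first by rewrite -leNgt; lra.
have fwc : f w <= f c by apply: Hc; rewrite in_itv /=; move: wx; rewrite ltr_norml; lra.
apply/negP => h.
have mr : Num.min (r / 2) r1 <= r1 by rewrite ge_min lexx orbT.
have /Hr1 : `|b - f c| < r1 by rewrite ltr_norml; lra.
by rewrite fb subrr sub0r normrN ltxx.
Qed.

(** The displacement has a positive minimum on [y, c]. Some jump of the orbit is smaller, so the
    orbit has left [y, c], and by Coppel's lemma not downwards. *)
Lemma exceeds_in_gap f y c : aperiodic f -> y < f y -> y <= c -> (forall t, y <= t <= c -> f t != t) ->
  exists m, c <= iter m f y.
Proof.
move=> tf fy yc nf; have [cf fr fp] := tf.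
have up t : y <= t <= c -> t < f t by apply: (@above_diag _ f y c y) => //; lra.
have cg : continuous (fun y => f y - y).
  by move=> ?; apply: continuousB; [exact: cf|exact: cvg_id].
have [|d /[!in_itv] /= dyc Hd] := @EVT_min _ (fun y => f y - y) y c yc.
  exact: continuous_subspaceT.
have k0 : 0 < f d - d by have := up d dyc; lra.
have [i] := small_jump y tf k0.
have [ci _|ic] := leP c (iter i f y); first by exists i.
have yi : y <= iter i f y.
  by case: i ic => [//|i] _; apply: ltW; apply: coppel.
have Hi : iter i f y \in `[y, c] by rewrite in_itv /=; lra.
have := Hd _ Hi; have := ler_norm (f (iter i f y) - iter i f y); lra.
Qed.

End UniformEstimates.

(** * Components of the complement of the fixed points *)

Section Gaps.
Context {R : realType}.
Implicit Types (f g : R -> R) (b p q w x y z : R).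

Definition jump f (e : R) z := e <= `|f z - z|.

(* A point from which the orbit either makes a large jump, or leaves for good
   the component of the complement of the fixed points that contains it. *)
Definition settled f e y := jump f e y \/
  forall j, (0 < j)%N -> exists2 q, f q = q & (y < q <= iter j f y) || (iter j f y <= q < y).

(* p is the endpoint, from which z moves away, of the component containing z of
   the complement of the fixed points. *)
Definition source f p z := f p = p /\
  ((p < z /\ z < f z /\ forall t, p < t <= z -> f t != t) \/
   (z < p /\ f z < z /\ forall t, z <= t < p -> f t != t)).

Lemma mirror_jump f e z : jump (mirror f) e (1 - z) <-> jump f e z.
Proof.
rewrite /jump /mirror subKr.
have -> : 1 - f z - (1 - z) = z - f z by ring.
by rewrite distrC.
Qed.

Lemma mirror_settled f e z : settled f e z -> settled (mirror f) e (1 - z).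
Proof.
case=> [h|h]; [by left; apply/mirror_jump|right => j /h[q fq hq]].
exists (1 - q); first by apply/mirror_fix; rewrite subKr.
rewrite iter_mirror subKr; move: hq => /orP[hq|hq]; apply/orP; [right|left]; lra.
Qed.

Lemma mirror_source f p z : source f p z -> source (mirror f) (1 - p) (1 - z).
Proof.
move=> [fp H]; split; first by apply/mirror_fix; rewrite subKr.
case: H => [[pz [fz H]]|[zp [fz H]]]; [right|left]; rewrite /mirror subKr.
- split; first lra; split; first lra.
  move=> t tp; apply/eqP => /mirror_fix ft; have /eqP[] : f (1 - t) != 1 - t by apply: H; lra.
  exact: ft.
- split; first lra; split; first lra.
  move=> t tp; apply/eqP => /mirror_fix ft; have /eqP[] : f (1 - t) != 1 - t by apply: H; lra.
  exact: ft.
Qed.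

(** The sign of [f t - t] is constant on a component, so all its points move away from the same
    end. *)
Lemma source_fixfree f p z z' : continuous f -> source f p z -> fixfree f z z' -> source f p z'.
Proof.
move=> cf [fp H] nf; split=> //.
have sp : ~~ (Num.min z z' <= p <= Num.max z z').
  by apply/negP => h; have /eqP := nf p h.
have zin : Num.min z z' <= z <= Num.max z z' by rewrite ge_min le_max !lexx.
have zin' : Num.min z z' <= z' <= Num.max z z' by rewrite ge_min le_max !lexx !orbT.
have nf2 t : z <= t <= z' -> f t != t by move=> h; apply: nf; rewrite ge_min le_max; lra.
have nf3 t : z' <= t <= z -> f t != t by move=> h; apply: nf; rewrite ge_min le_max; lra.
case: H => [[pz [fz H]]|[zp [fz H]]]; [left|right].
- have pz' : p < z'.
    rewrite ltNge; apply/negP => z'p; move/negP: sp; apply.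
    by rewrite ge_min le_max z'p (ltW pz) orbT.
  split => //; split; first exact: (above_diag cf nf zin fz zin').
  move=> t tp; have [tz|zt] := leP t z; first by apply: H; lra.
  by apply: nf2; lra.
- have pz' : z' < p.
    rewrite ltNge; apply/negP => z'p; move/negP: sp; apply.
    by rewrite ge_min le_max z'p (ltW zp) orbT.
  split => //; split; first exact: (below_diag cf nf zin fz zin').
  move=> t tp; have [tz|zt] := leP z t; first by apply: H; lra.
  by apply: nf3; lra.
Qed.

(** Once a step up is followed by a step down, Coppel's lemma traps the later orbit between y and
    [f y], so no later jump is longer than the one at y. *)
Lemma up_down_jump f e y t : aperiodic f -> y < f y -> f (f y) < f y ->
  jump f e (iter t.+1 f y) -> jump f e y.
Proof.
move=> tf fy ffy; rewrite /jump => h; apply: (le_trans h).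
have lo n : y < iter n.+1 f y by apply: coppel.
have hi n : iter n.+1 f y <= f y.
  by case: n => [//|n]; rewrite iterSr; apply/ltW/coppel_down.
rewrite [leRHS]gtr0_norm ?subr_gt0 // ler_norml -iterS.
by have := lo t; have := hi t; have := lo t.+1; have := hi t.+1; lra.
Qed.

Lemma down_up_jump f e y t : aperiodic f -> f y < y -> f y < f (f y) ->
  jump f e (iter t.+1 f y) -> jump f e y.
Proof.
move=> tf fy ffy /mirror_jump h; apply/mirror_jump.
apply: (@up_down_jump _ _ _ t (mirror_aperiodic tf)).
- by rewrite /mirror subKr; lra.
- by rewrite /mirror !subKr; lra.
- by rewrite iter_mirror subKr.
Qed.

(** A fixed point q lies in []y, f y]]. If [f y] moves up, the orbit stays above q for good; if it
    moves down, the later jump forces one at y by [up_down_jump]; if it is fixed, there is no later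
    jump. *)
Lemma settled_exit_up f (e : R) y t : aperiodic f -> 0 < e -> y < f y ->
  ~ fixfree f y (f y) -> jump f e (iter t.+1 f y) -> settled f e y.
Proof.
move=> tf e0 fy nfree h.
have [q fq qy] : exists2 q, f q = q & y < q <= f y.
  apply: contrapT => no; apply: nfree; apply/fixfree_le; first exact: ltW.
  move=> t' ty; apply/eqP => ft; apply: no; exists t' => //.
  have [E|] := eqVneq t' y; first by move: fy; rewrite -E ft ltxx.
  by rewrite neq_lt; lra.
case: (ltgtP (f y) (f (f y))) => [up|dn|E].
- right; case=> [//|j] _; exists q => //; apply/orP; left.
  suff : f y <= iter j.+1 f y by lra.
  by case: j => [//|j]; rewrite iterSr; apply/ltW/coppel.
- by left; apply: up_down_jump dn h.
- exfalso; move: h; rewrite /jump iterSr iter_fix // -?E // subrr normr0; lra.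
Qed.

Lemma settled_exit f (e : R) y t : aperiodic f -> 0 < e ->
  ~ fixfree f y (f y) -> jump f e (iter t.+1 f y) -> settled f e y.
Proof.
move=> tf e0 nfree h.
case: (ltgtP y (f y)) => [up|dn|E].
- exact: settled_exit_up h.
- rewrite -[f]mirrorK -[y](subKr 1); apply: mirror_settled.
  apply: (@settled_exit_up _ _ _ t (mirror_aperiodic tf) e0).
  + by rewrite /mirror subKr; lra.
  + move=> fr; apply: nfree; rewrite /mirror subKr in fr.
    apply/fixfreeC/fixfree_le; first exact: ltW.
    have le : 1 - y <= 1 - f y by lra.
    move: fr => /(fixfree_le _ le) fr u uy; apply/eqP => fu.
    have /eqP[] : mirror f (1 - u) != 1 - u by apply: fr; lra.
    by apply/mirror_fix; rewrite subKr.
  + by rewrite iter_mirror subKr; apply/mirror_jump.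
- exfalso; move: h; rewrite /jump iter_fix // -?E // subrr normr0; lra.
Qed.

Lemma fixfree_trans f x y z : fixfree f x y -> fixfree f y z -> fixfree f x z.
Proof.
move=> H1 H2 t; rewrite ge_min le_max => /andP[h1 h2].
have [ty|yt] := leP t y.
  case/orP: h1 => h1; first by apply: H1; rewrite ge_min le_max h1 ty orbT.
  by apply: H2; rewrite ge_min le_max h1 ty orbT.
case/orP: h2 => h2; first by apply: H1; rewrite ge_min le_max h2 (ltW yt) orbT.
by apply: H2; rewrite ge_min le_max h2 (ltW yt) orbT.
Qed.

(** The orbit is followed while it stays in the component of y. The last point before it leaves is
    settled by [settled_exit], thanks to the jump still to come; if it does not leave before time t,
    the point of the jump itself is settled. *)
Lemma exists_settled f (e : R) y t : aperiodic f -> 0 < e -> jump f e (iter t f y) ->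
  exists i, [/\ (i <= t)%N, fixfree f y (iter i f y) & settled f e (iter i f y)].
Proof.
move=> tf e0; elim: t y => [|t IH] y h.
  exists 0%N; split => //; last by left.
  apply/fixfree_le => //= u uy; have -> : u = y by lra.
  by apply/eqP => fy; move: h; rewrite /jump /= fy subrr normr0; lra.
have [fr|nfr] := pselect (fixfree f y (f y)).
  have [|i [it fr' st]] := IH (f y); first by rewrite -iterSr.
  exists i.+1; rewrite iterSr; split => //.
  exact: fixfree_trans fr'.
exists 0%N; split => //; last exact: settled_exit h.
apply/fixfree_le => //= u uy; have -> : u = y by lra.
apply/eqP => fy; move: h; rewrite /jump iter_fix // fy subrr normr0; lra.
Qed.

(** The orbit is followed while it rises: it either rises up to time t or turns, and then the
    turning step is a large jump by [up_down_jump]. *)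
Lemma up_run f (e : R) y t : aperiodic f -> 0 < e -> y < f y -> jump f e (iter t f y) ->
  exists j, [/\ (j <= t)%N, y <= iter j f y, iter j f y < f (iter j f y)
    & jump f e (iter j f y)].
Proof.
move=> tf e0; elim: t y => [|t IH] y fy h; first by exists 0%N.
case: (ltgtP (f y) (f (f y))) => [up|dn|E].
- have [|j [jt yj uj Jj]] := IH (f y) up; first by rewrite -iterSr.
  by exists j.+1; rewrite iterSr; split => //; lra.
- exists 0%N; split => //; exact: up_down_jump h.
- exfalso; move: h; rewrite /jump iterSr iter_fix // -?E // subrr normr0; lra.
Qed.

Lemma down_run f (e : R) y t : aperiodic f -> 0 < e -> f y < y -> jump f e (iter t f y) ->
  exists j, [/\ (j <= t)%N, iter j f y <= y, f (iter j f y) < iter j f y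
    & jump f e (iter j f y)].
Proof.
move=> tf e0 fy h.
have [||j [jt]] := @up_run (mirror f) e (1 - y) t (mirror_aperiodic tf) e0.
- by rewrite /mirror subKr; lra.
- by rewrite iter_mirror subKr; apply/mirror_jump.
rewrite iter_mirror subKr => yj; rewrite /mirror subKr => uj /mirror_jump Jj.
by exists j; split => //; lra.
Qed.

Lemma exists_source f (e : R) : aperiodic f -> 0 < e -> exists M, forall z t, 0 <= z <= 1 ->
  (M <= t)%N -> jump f e (iter t f z) ->
  exists i p, [/\ (i <= t)%N, source f p (iter i f z) & settled f e (iter i f z)].
Proof.
move=> tf e0; have [cf fr fp] := tf.
have [r r0 Hr] := jump_far cf e0 fr.
have [r' r'0 Hr'] := far_from_fixpoints cf r0.
have [L HL] := small_jump_uniform tf r'0.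
exists L => z t z01 Lt Jt.
suff [i [p [it sp]]] : exists i p, (i <= t)%N /\ source f p (iter i f z).
  have [|j [jt fj sj]] := @exists_settled f e (iter i f z) (t - i) tf e0; first by rewrite -iterD subnK.
  exists (j + i)%N, p; rewrite iterD; split => //; first by rewrite -(subnK it) leq_add2r.
  exact: source_fixfree fj.
apply: contrapT => no.
have [i iL] := HL z z01; apply/negP; rewrite -leNgt; apply: Hr'; first exact: orbit01.
move=> q fq; set y := iter i f z.
have it : (i <= t)%N by lia.
have Jy : jump f e (iter (t - i) f y) by rewrite -iterD subnK.
case: (ltgtP y (f y)) => [up|dn|E].
- have [j [jt yj uj Jj]] := up_run tf e0 up Jy.
  have nofix q' : f q' = q' -> q' < iter j f y -> False.
    move=> fq' qy; have [|p [fp' pb np]] := last_fixpoint cf fq' (_ : q' <= iter j f y); first lra.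
    apply: no; exists (j + i)%N, p; split; first by rewrite -(subnK it) leq_add2r.
    rewrite iterD -/y; split => //; left; split => //.
    rewrite lt_neqAle; apply/andP; split; last lra.
    by apply/eqP => E; move: uj; rewrite -E fp' ltxx.
  have [qj|jq] := ltP q (iter j f y); first by have := nofix q fq qj.
  have := Hr _ (orbit01 (j + i) tf z01) _ q fq; rewrite iterD -/y => /(_ Jj).
  rewrite !ger0_norm ?subr_ge0 //; lra.
- have [j [jt yj uj Jj]] := down_run tf e0 dn Jy.
  have nofix q' : f q' = q' -> iter j f y < q' -> False.
    move=> fq' qy; have [|p [fp' pb np]] := first_fixpoint cf fq' (_ : iter j f y <= q'); first lra.
    apply: no; exists (j + i)%N, p; split; first by rewrite -(subnK it) leq_add2r.
    rewrite iterD -/y; split => //; right; split => //.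
    rewrite lt_neqAle; apply/andP; split; last lra.
    by apply/eqP => E; move: uj; rewrite E fp' ltxx.
  have [qj|jq] := ltP (iter j f y) q; first by have := nofix q fq qj.
  have := Hr _ (orbit01 (j + i) tf z01) _ q fq; rewrite iterD -/y => /(_ Jj).
  rewrite !ler0_norm ?subr_le0 //; lra.
- exfalso; move: Jy; rewrite /jump iter_fix // -?E // subrr normr0; lra.
Qed.

(** The union of the forward images of [p, z]. When p is a source of z these images increase,
    because [p, z] covers itself, and the union is convex. *)
Definition reached f p z y := exists m u, p <= u <= z /\ iter m f u = y.

Lemma reached_self f p z m n u : aperiodic f -> f p = p -> p < z -> z < f z ->
  p <= u <= z -> exists2 u', p <= u' <= z & iter (m + n) f u' = iter n f u.
Proof.
move=> tf fp pz fz pu; have [cf _ _] := tf.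
have cov : covers (iter m f) p z p z.
  apply: (@covers_ivt _ _ _ _ _ _ p z) => //; try lra.
  - exact: continuous_iter.
  - by rewrite iter_fix.
  - by case: m => [//|m]; apply/ltW/coppel.
by have [u' u'pz <-] := cov u pu; exists u' => //; rewrite addnC iterD.
Qed.

Lemma reached_convex f p z y1 y2 y : aperiodic f -> f p = p -> p < z -> z < f z ->
  reached f p z y1 -> reached f p z y2 -> y1 <= y <= y2 -> reached f p z y.
Proof.
move=> tf fp pz fz [m1 [u1 [pu1 <-]]] [m2 [u2 [pu2 <-]]] yb.
have [v1 pv1 E1] := reached_self m2 m1 tf fp pz fz pu1.
have [v2 pv2 E2] := reached_self m1 m2 tf fp pz fz pu2.
have [cf _ _] := tf.
have [|||t tpz E] := @covers_ivt _ (iter (m1 + m2) f) p z _ _ v1 v2 _ pv1 pv2 _ _ y yb.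
- exact: continuous_iter.
- by rewrite addnC E1.
- by rewrite E2.
by exists (m1 + m2)%N, t.
Qed.

End Gaps.

(** * From one source to the next *)

Section NextSource.
Context {R : realType}.
Implicit Types (f g : R -> R) (b p q w x y z : R).

(* If no such i existed, then up to time t the points moving up would stay in the
   component of z and those moving down in a single other one, at a definite
   distance from all fixed points. Then every jump up to time t is bounded
   below, which small_jump_uniform excludes for large t. *)
Lemma next_source_up f (e : R) : aperiodic f -> 0 < e -> exists M, forall z p t, 0 <= z <= 1 ->
  source f p z -> z < f z -> settled f e z -> (M <= t)%N -> jump f e (iter t f z) ->
  exists i p', [/\ (0 < i <= t)%N, source f p' (iter i f z), settled f e (iter i f z),
    z < p' & reached f p z p'].
Proof.
move=> tf e0; have [cf fr fp] := tf.
have [r r0 Hr] := jump_far cf e0 fr.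
have [s s0 Hs] := preimage_near cf e0.
have m0 : 0 < Num.min r s by rewrite lt_min r0.
have mr : Num.min r s <= r by rewrite ge_min lexx.
have ms : Num.min r s <= s by rewrite ge_min lexx orbT.
have [r' r'0 Hr'] := far_from_fixpoints cf m0.
have [L HL] := small_jump_uniform tf r'0.
exists L.+1 => z p t z01 [fpp src] fz stz Lt Jt.
have [pz nz] : p < z /\ forall u, p < u <= z -> f u != u.
  by case: src => [[? [_ ?]]|[_ [? _]]]; [split|lra].
pose zz i := iter i f z.
have zgt i : (0 < i)%N -> z < zz i by case: i => [//|i] _; apply: coppel.
have zge i : z <= zz i by case: i => [//|i]; apply/ltW/zgt.
have z01' i : 0 <= zz i <= 1 by apply: orbit01.
pose E := reached f p z.
have Ez i : E (zz i) by exists i, z; split => //; lra.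
have Ep : E p by exists 0%N, p; split => //; lra.
have Ec y1 y2 y : E y1 -> E y2 -> y1 <= y <= y2 -> E y by apply: reached_convex.
have EpI i y : p <= y <= zz i -> E y by apply: Ec.
have tail i : (i <= t)%N -> jump f e (iter (t - i) f (zz i)).
  by move=> it; rewrite /zz -iterD subnK.
have nfix i : (i <= t)%N -> f (zz i) <> zz i.
  move=> /tail h fi; move: h; rewrite /jump iter_fix // fi subrr normr0; lra.
suff [i [p' [it [sp zp' Ep']]]] : exists i p', (0 < i <= t)%N /\ [/\ source f p' (zz i), z < p' & E p'].
  have [i0 it'] := andP it.
  have [j [jt fj sj]] := exists_settled tf e0 (tail i it').
  exists (j + i)%N, p'; rewrite iterD; split => //.
    by rewrite addn_gt0 i0 orbT -(subnK it') leq_add2r.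
  exact: source_fixfree fj.
apply: contrapT => no.
have upF i q : (0 < i <= t)%N -> zz i < f (zz i) -> f q = q -> z <= q <= zz i -> False.
  move=> it up fq qb.
  have [|p' [fp' pb np]] := last_fixpoint cf fq (_ : q <= zz i); first lra.
  apply: no; exists i, p'; split => //; split.
  - split => //; left; split => //.
    rewrite lt_neqAle; apply/andP; split; last lra.
    by apply/eqP => pE; apply: (nfix i); [case/andP: it|rewrite -pE].
  - rewrite lt_neqAle; apply/andP; split; last lra.
    by apply/eqP => zE; move: fz; rewrite zE fp' ltxx.
  - by apply: (EpI i); lra.
have dnF i q : (0 < i <= t)%N -> f (zz i) < zz i -> f q = q -> zz i <= q -> E q -> False.
  move=> it dn fq qi Eq.
  have [p' [fp' pb np]] := first_fixpoint cf fq qi.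
  apply: no; exists i, p'; split => //; split.
  - split => //; right; split => //.
    rewrite lt_neqAle; apply/andP; split; last lra.
    by apply/eqP => pE; apply: (nfix i); [case/andP: it|rewrite pE].
  - by have := zgt i (proj1 (andP it)); lra.
  - by apply: (Ec (zz i) q) => //; lra.
have J_up_dn i : (i < t)%N -> zz i < f (zz i) -> f (zz i.+1) < zz i.+1 -> jump f e (zz i).
  move=> it up dn; apply: (up_down_jump tf up dn (t := (t - i.+1)%N)).
  by rewrite -subSn // subSS /zz -iterD subnK // ltnW.
have J_dn_up i : (i < t)%N -> f (zz i) < zz i -> zz i.+1 < f (zz i.+1) -> jump f e (zz i).
  move=> it up dn; apply: (down_up_jump tf up dn (t := (t - i.+1)%N)).
  by rewrite -subSn // subSS /zz -iterD subnK // ltnW.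
have t0 : (0 < t)%N by apply: leq_trans Lt.
(* Here [settled] enters: if [f z] rises and the jump at z is small, a fixed point lies between z
   and [f z], against [upF]. So z keeps the distance r from all fixed points. *)
have Jz : jump f e z.
  case: (ltgtP (f z) (f (f z))) => [up|dn|fE].
  - case: stz => // /(_ 1%N isT)[q fq /orP[qb|qb]].
      by exfalso; apply: (upF 1%N q) => //=; move: qb; rewrite /zz /=; lra.
    by exfalso; have := zgt 1%N isT; rewrite /zz /=; move: qb; rewrite /=; lra.
  - exact: (J_up_dn 0%N).
  - by exfalso; apply: (nfix 1%N).
have [i iL] := HL z z01; apply/negP; rewrite -leNgt -/(zz i); apply: Hr' => // q fq.
have it : (i <= t)%N by apply: leq_trans iL (ltnW Lt).
have zq : r <= `|q - z| by apply: Hr.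
case: (ltgtP (zz i) (f (zz i))) => [up|dn|fE]; last by exfalso; apply: (nfix i).
- have [j [jt zj uj Jj]] := up_run tf e0 up (tail i it).
  rewrite -iterD -/(zz (j + i)%N) in zj uj Jj.
  have qj : r <= `|q - zz (j + i)%N| by apply: Hr.
  have zi := zge i.
  have jit : (j + i <= t)%N by rewrite -(subnK it) leq_add2r.
  have nq : ~ (z <= q <= zz (j + i)%N).
    move=> qb; case: (posnP (j + i)) => [jE|ji0].
      move: qb; rewrite jE /zz /= => qb; have qE : q = z by lra.
      by move: fz; rewrite -qE fq ltxx.
    by apply: (upF (j + i)%N q) => //; rewrite ji0.
  have [qz|zq'] := ltP q z.
    by move: zq; rewrite !ltr0_norm ?subr_lt0 //; lra.
  have qzj : zz (j + i)%N < q by rewrite ltNge; apply/negP => h; apply: nq; lra.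
  by move: qj; rewrite !gtr0_norm ?subr_gt0 //; lra.
have i0 : (0 < i)%N by case: i iL it dn => // _ _; rewrite /zz /=; lra.
(* The last turn from rising to falling before time i: from [i1.+1] to i the orbit falls, so
   [zz i1.+1] is the highest of these points. *)
have [i1 [i1i up1 dn1 le1]] : exists i1, [/\ (i1 < i)%N, zz i1 < f (zz i1), f (zz i1.+1) < zz i1.+1
    & zz i <= zz i1.+1].
  have {iL} : (i <= t)%N by []. 
  elim: i i0 it dn => [//|i IH] _ it dn _.
  case: (ltgtP (zz i) (f (zz i))) => [up|dn'|fE].
  - by exists i.
  - have i0 : (0 < i)%N by case: i {IH it dn} dn' => // ; rewrite /zz /=; lra.
    have [i1 [h1 h2 h3 h4]] := IH i0 (ltnW it) dn' (ltnW it).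
    exists i1; split => //; first exact: leqW.
    by apply: le_trans h4; apply: ltW.
  - by exfalso; apply: (nfix i) => //; apply: ltnW.
have i1t : (i1 < t)%N by apply: leq_trans it.
have [j [jt zj uj Jj]] := down_run tf e0 dn (tail i it).
rewrite -iterD -/(zz (j + i)%N) in zj uj Jj.
have jit : (0 < j + i <= t)%N by rewrite addn_gt0 i0 orbT -(subnK it) leq_add2r.
have qj : r <= `|q - zz (j + i)%N| by apply: Hr.
have [qz|zq'] := ltP q (zz (j + i)%N).
  by move: qj; rewrite !ltr0_norm ?subr_lt0 //; lra.
have zji := zge (j + i)%N.
have qbig : zz i1.+1 < q.
  rewrite ltNge; apply/negP => h.
  by apply: (dnF _ q jit) => //; apply: (EpI i1.+1); lra.
rewrite gtr0_norm ?subr_gt0; last lra.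
rewrite leNgt; apply/negP => qs.
(* If q were this close above [zz i1.+1 = f (zz i1)], the first fixed point b above it would be the
   image of some w' in the component of [zz i1]. As w' is reached, so is b, against [dnF]. *)
have [b [fb bq nb]] := first_fixpoint cf fq (ltW qbig).
have bz : zz i1.+1 < b.
  rewrite lt_neqAle; apply/andP; split; last lra.
  by apply/eqP => bE; move: dn1; rewrite bE fb ltxx.
have J1 := J_up_dn _ i1t up1 dn1.
have [||w' fw' ww'] := Hs _ (z01' i1) J1 _ b fb _ nb.
- exact: (nfix i1.+1 i1t).
- rewrite -[f (zz i1)]/(zz i1.+1); lra.
apply: (dnF i1.+1 b) => //; first lra.
(* Below [zz i1] the point w' stays above p, since no fixed point separates them; above it, some
   later iterate of [zz i1] passes w'. *)
have Ew : E w'.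
  have [wz|zw] := leP w' (zz i1).
    apply: (EpI i1); rewrite wz andbT leNgt; apply/negP => wp.
    have h : f p != p by apply: ww'; rewrite ge_min le_max (ltW wp) orbT /=; have := zge i1; lra.
    by move: h; rewrite fpp eqxx.
  have [|m wm] := exceeds_in_gap tf up1 (ltW zw).
    by apply/fixfree_le => //; exact: ltW.
  apply: (EpI (m + i1)%N); rewrite /zz iterD -/(zz i1) wm andbT.
  by have := zge i1; lra.
have [m [u [pu uw]]] := Ew.
by exists m.+1, u; rewrite iterS uw.
Qed.

End NextSource.

(** * Chains from widely spaced large jumps *)

Section ChainsFromJumps.
Context {R : realType}.
Implicit Types (f g : R -> R) (b p q w x y z : R).

Lemma covers_mirror f n a b c d : covers (iter n (mirror f)) a b c d ->
  covers (iter n f) (1 - b) (1 - a) (1 - d) (1 - c).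
Proof.
move=> H y ycd; have [|t tab] := H (1 - y); first lra.
by rewrite iter_mirror => E; exists (1 - t); lra.
Qed.

(** A threshold [N0] in place of a single time lets one common iterate realise all links of a
    chain. *)
Definition linked f p z p' z' := (Num.max p z < Num.min p' z' \/ Num.max p' z' < Num.min p z) /\
  exists N0, forall N, (N0 <= N)%N ->
    covers (iter N f) (Num.min p z) (Num.max p z) (Num.min p' z') (Num.max p' z').

Lemma minrB p z : Num.min (1 - p) (1 - z) = 1 - Num.max p z.
Proof. by case: (lerP p z) => h; [rewrite (min_idPr _)|rewrite (min_idPl _)] => //; lra. Qed.

Lemma maxrB p z : Num.max (1 - p) (1 - z) = 1 - Num.min p z.
Proof. by case: (lerP p z) => h; [rewrite (max_idPl _)|rewrite (max_idPr _)] => //; lra. Qed.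

Lemma linked_mirror f p z p' z' : linked (mirror f) p z p' z' -> linked f (1 - p) (1 - z) (1 - p') (1 - z').
Proof.
move=> [dis [N0 H]]; split.
  by rewrite !minrB !maxrB; case: dis; [right|left]; lra.
by exists N0 => N NN; rewrite !minrB !maxrB; apply: covers_mirror; apply: H.
Qed.

(** The images of [p, z] increase, so every late one contains p' and [iter i f z], hence the
    interval between them. Both points lie above z, the second by Coppel's lemma. *)
Lemma linked_up f p z p' i : aperiodic f -> f p = p -> p < z -> z < f z -> (0 < i)%N ->
  z < p' -> reached f p z p' -> linked f p z p' (iter i f z).
Proof.
move=> tf fp pz fz i0 zp' [m [u [pu up']]]; have [cf _ _] := tf.
have zi : z < iter i f z by case: i i0 => [//|i] _; apply: coppel.
rewrite /linked (max_idPr (ltW pz)) (min_idPl (ltW pz)); split.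
  by left; rewrite lt_min zp'.
exists (m + i)%N => N mN.
have zz : p <= z <= z by lra.
have [u1 pu1 E1] := reached_self (N - m) m tf fp pz fz pu.
have [u2 pu2 E2] := reached_self (N - i) i tf fp pz fz zz.
rewrite subnK in E1; last by apply: leq_trans mN; apply: leq_addr.
rewrite subnK in E2; last by apply: leq_trans mN; apply: leq_addl.
have cN : continuous (iter N f) by apply: continuous_iter.
have [h|h] := leP p' (iter i f z).
  by apply: (covers_ivt cN pu1 pu2); rewrite ?E1 ?E2 ?up'.
by apply: (covers_ivt cN pu2 pu1); rewrite ?E1 ?E2 ?up'.
Qed.

Lemma next_source f (e : R) : aperiodic f -> 0 < e -> exists M, forall z p t, 0 <= z <= 1 ->
  source f p z -> settled f e z -> (M <= t)%N -> jump f e (iter t f z) ->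
  exists i p', [/\ (i <= t)%N, source f p' (iter i f z), settled f e (iter i f z)
    & linked f p z p' (iter i f z)].
Proof.
move=> tf e0; have tf' := mirror_aperiodic tf.
have [M1 H1] := next_source_up tf e0; have [M2 H2] := next_source_up tf' e0.
exists (maxn M1 M2) => z p t z01 src st; rewrite geq_max => /andP[M1t M2t] J.
case: (src) => fp [[pz [fz _]]|[zp [fz _]]].
  have [i [p' [/andP[i0 it] sp si zp' rp']]] := H1 z p t z01 src fz st M1t J.
  by exists i, p'; split => //; apply: linked_up.
have [||||||i [p' [/andP[i0 it] sp si zp' rp']]] := H2 (1 - z) (1 - p) t.
- lra.
- exact: mirror_source.
- by rewrite /mirror subKr; lra.
- exact: mirror_settled.
- exact: M2t.
- by rewrite iter_mirror subKr; apply/mirror_jump.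
exists i, (1 - p'); rewrite iter_mirror subKr in sp si.
have := mirror_source sp; have := mirror_settled si; rewrite mirrorK !subKr => {}si {}sp.
split => //.
have : linked (mirror f) (1 - p) (1 - z) p' (iter i (mirror f) (1 - z)).
  apply: linked_up => //; first by apply/mirror_fix; rewrite subKr.
    lra.
  by rewrite /mirror subKr; lra.
by rewrite iter_mirror subKr => /linked_mirror; rewrite !subKr.
Qed.

(** The first jump also has to wait for M steps, which leaves room for a source before it. *)
Fixpoint spaced_jumps f (e : R) M k x : Prop :=
  if k is k'.+1 then exists t, [/\ (M <= t)%N, jump f e (iter t f x)
    & spaced_jumps f e M k' (iter t f x)]
  else True.

Lemma source_cover f p z : aperiodic f -> source f p z -> forall N,
  covers (iter N f) (Num.min p z) (Num.max p z) (Num.min p z) (Num.max p z).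
Proof.
move=> tf [fp src] N; have [cf _ _] := tf.
have cN : continuous (iter N f) by apply: continuous_iter.
case: src => [[pz [fz _]]|[zp [fz _]]].
  rewrite (max_idPr (ltW pz)) (min_idPl (ltW pz)).
  apply: (@covers_ivt _ _ _ _ _ _ p z) => //; try lra; first by rewrite iter_fix.
  by case: N {cN} => [//|N]; apply/ltW/coppel.
rewrite (max_idPl (ltW zp)) (min_idPr (ltW zp)).
apply: (@covers_ivt _ _ _ _ _ _ z p) => //; try lra; last by rewrite iter_fix.
by case: N {cN} => [//|N]; apply/ltW/coppel_down.
Qed.

(** The jumps are counted from [iter s f z] and not from z, because the next source is found at some
    unspecified time up to the jump that reveals it. *)
Lemma jumps_chain f (e : R) : aperiodic f -> 0 < e -> exists M, forall k z p s, 0 <= z <= 1 ->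
  source f p z -> settled f e z -> spaced_jumps f e M k (iter s f z) ->
  exists N0, forall N, (N0 <= N)%N -> chain (iter N f) k.+1 (Num.min p z) (Num.max p z).
Proof.
move=> tf e0; have [cf fr fp] := tf; have [M H] := next_source tf e0; exists M.
have bounds z p : 0 <= z <= 1 -> source f p z ->
    [/\ 0 <= Num.min p z, Num.min p z <= Num.max p z & Num.max p z <= 1].
  move=> z01 [fpp _]; have p01 := fr p; rewrite fpp in p01.
  by rewrite le_min ge_max ge_min le_max !lexx; split; lra.
elim=> [|k IH] z p s z01 src st.
  move=> _; have [b0 b1 b2] := bounds _ _ z01 src; exists 1%N => N N1.
  have cov := source_cover tf src.
  (* The last interval of a chain may be a single point: [f z] is covered, and lies beyond z. *)
  do !split => //; exists (f z), (f z); split.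
  - move=> y yf; have -> : y = f z by lra.
    have [|t tz E] := cov N.-1 z; first by rewrite ge_min le_max !lexx !orbT.
    by exists t => //; rewrite -(prednK N1) iterS E.
  - case: src => _ [[pz [fz _]]|[zp [fz _]]]; [left|right].
      by rewrite (max_idPr (ltW pz)).
    by rewrite (min_idPr (ltW zp)).
  - by have := fr z; do !split; lra.
move=> [t [Mt J sj]].
have [||i [p' [it src' st' [dis [N1 HN1]]]]] := H z p (t + s)%N z01 src st.
- exact: leq_trans Mt (leq_addr _ _).
- by rewrite iterD.
have [|N2 HN2] := IH (iter i f z) p' (t + s - i)%N (orbit01 i tf z01) src' st'.
  by rewrite -iterD subnK // iterD.
have [b0 b1 b2] := bounds _ _ z01 src.
exists (maxn N1 N2) => N; rewrite geq_max => /andP[N1N N2N].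
split=> //; split => //; split => //; split; first exact: source_cover.
by eexists; eexists; split; [exact: HN1|exact: dis|exact: HN2].
Qed.

Lemma spaced_jumps_has_chain f (e : R) : aperiodic f -> 0 < e -> exists M, forall k x,
  0 <= x <= 1 -> spaced_jumps f e M k x -> has_chain f k.
Proof.
move=> tf e0; have [M1 H1] := exists_source tf e0; have [M2 H2] := jumps_chain tf e0.
exists (maxn M1 M2) => -[|k] x x01.
  by move=> _; exists 1%N => //; exists 0, 1; do !split; lra.
move=> [t [Mt J sj]].
have weaken k' y : spaced_jumps f e (maxn M1 M2) k' y -> spaced_jumps f e M2 k' y.
  elim: k' y => [//|k' IH] y [u [Mu Ju su]]; exists u; split => //; last exact: IH.
  exact: leq_trans (leq_maxr _ _) Mu.
have [i [p [it src st]]] := H1 x t x01 (leq_trans (leq_maxl _ _) Mt) J.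
have [|N0 HN] := H2 k (iter i f x) p (t - i)%N (orbit01 i tf x01) src st.
  by rewrite -iterD subnK //; apply: weaken.
exists N0.+1 => //; exists (Num.min p (iter i f x)), (Num.max p (iter i f x)).
exact: HN.
Qed.

End ChainsFromJumps.

(** * The upper bound *)

Section Coding.
Context {R : realType}.
Implicit Types (f g : R -> R) (a b c x y z : R) (s cs : seq R).

(** Near a point c that is not fixed all displacements are bounded below, so crossing c needs a
    large jump. If all of ]a, b[ is fixed, the midpoint can only be crossed from outside, by a jump
    of at least half the length. *)
Lemma good_cut f a b : continuous f -> a < b -> exists2 c, a < c < b &
  exists2 e : R, 0 < e & forall x, (x <= c) != (f x <= c) -> jump f e x.
Proof.
move=> cf ab.
have [all|] := pselect (forall x, a < x < b -> f x = x).
  exists ((a + b) / 2); first lra.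
  exists ((b - a) / 2); first lra.
  move=> x cr; rewrite /jump leNgt; apply/negP => h.
  have fx : f x = x.
    apply: all; move: cr h; rewrite ltr_norml.
    by case: (leP x ((a + b) / 2)) => h1; case: (leP (f x) ((a + b) / 2)) => h2 //= _ /andP[h3 h4]; lra.
  by move: cr; rewrite fx eqxx.
move=> /existsNP[c /not_implyP[acb /eqP nc]].
exists c => //.
have d0 : 0 < `|f c - c| by rewrite normr_gt0 subr_eq0.
have cg : continuous (fun y => f y - y).
  by move=> ?; apply: continuousB; [exact: cf|exact: cvg_id].
have [|r r0 Hr] := @continuous_eps _ _ c (`|f c - c| / 2) cg; first lra.
have m0 : 0 < Num.min r (`|f c - c| / 2) by rewrite lt_min r0; lra.
exists (Num.min r (`|f c - c| / 2)) => // x cr; rewrite /jump leNgt; apply/negP.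
rewrite lt_min => /andP[h1 h2].
have /Hr : `|x - c| < r.
  move: cr h1; rewrite !ltr_norml; case: (leP x c) => h; case: (leP (f x) c) => h' //= _ /andP[h3 h4]; apply/andP; split; lra.
have := ler_distD (f x - x) (f c - c) 0; rewrite !subr0 [X in _ <= X + _]distrC; lra.
Qed.

Lemma good_cuts f (h : R) N : continuous f -> 0 < h -> exists cs,
  (forall i, (i < N)%N -> exists2 c, c \in cs & i%:R * h < c < i.+1%:R * h) /\
  exists2 e : R, 0 < e & forall x c, c \in cs -> (x <= c) != (f x <= c) -> jump f e x.
Proof.
move=> cf h0; elim: N => [|N [cs [H [e e0 He]]]]; first by exists [::]; split => //; exists 1.
have [|c cN [e' e'0 He']] := @good_cut f (N%:R * h) (N.+1%:R * h) cf.
  by rewrite ltr_pM2r // ltr_nat.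
exists (c :: cs); split.
  move=> i; rewrite ltnS leq_eqVlt => /predU1P[->|/H[d dcs hd]].
    by exists c => //; rewrite mem_head.
  by exists d => //; rewrite inE dcs orbT.
exists (Num.min e e'); first by rewrite lt_min e0.
move=> x d; rewrite inE => /predU1P[->|dcs] /=.
  by move/He'; apply: le_trans; rewrite ge_min lexx orbT.
by move/(He x d dcs); apply: le_trans; rewrite ge_min lexx.
Qed.

Lemma separating_cuts f (e : R) : continuous f -> 0 < e -> exists cs,
  (forall x y, 0 <= x -> y <= 1 -> e < y - x -> exists2 c, c \in cs & x < c < y) /\
  exists2 d : R, 0 < d & forall x c, c \in cs -> (x <= c) != (f x <= c) -> jump f d x.
Proof.
(* An interval longer than e contains a whole cell of the grid of mesh [e / 2], hence a cut. *)
move=> cf e0; pose h := e / 2; have h0 : 0 < h by rewrite /h; lra.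
have hE : e = h + h by rewrite /h; lra.
pose N := (Num.truncn h^-1).+1.
have [cs [H Hd]] := @good_cuts f h N.+1 cf h0; exists cs; split => // x y x0 y1 xy.
pose i := (Num.truncn (x / h)).+1.
have xh0 : 0 <= x / h by rewrite divr_ge0 // ltW.
have := truncn_itv xh0; rewrite -/i -natr1 => /andP[t1 t2].
rewrite ler_pdivlMr // in t1; rewrite natr1 -/i ltr_pdivrMr // in t2.
have t3 : i%:R * h <= x + h by rewrite /i -natr1 mulrDl mul1r; lra.
have iN : (i < N.+1)%N.
  have : i%:R < h^-1 by rewrite -[h^-1]mul1r ltr_pdivlMr //; lra.
  by move/lt_trans => /(_ _ (truncnS_gt _)); rewrite ltr_nat => /ltnW.
have [c ccs hc] := H i iN; exists c => //.
have : i.+1%:R * h = i%:R * h + h by rewrite -natr1 mulrDl mul1r.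
lra.
Qed.

(** A greedy choice: jumps before time M belong to the window opened at 0, and the first later one
    opens the next window. If this can be done [k + 1] times, the jumps are spaced. *)
Lemma jump_windows f (e : R) M k x n : (0 < n)%N -> spaced_jumps f e M k.+1 x \/
  exists ts : seq nat, [/\ size ts = k, all (fun t => t < n)%N ts &
    forall i, (i < n)%N -> jump f e (iter i f x) ->
      exists2 t, t \in 0%N :: ts & (t <= i < t + M)%N].
Proof.
elim: k x n => [|k IH] x n n0.
  have [[t [Mt Jt]]|no] := pselect (exists t, (M <= t)%N /\ jump f e (iter t f x)).
    by left; exists t.
  right; exists [::]; split => // i _ Ji; exists 0%N => //=.
  by rewrite add0n ltnNge; apply/negP => h; apply: no; exists i.
pose P t := `[< (M <= t < n)%N /\ jump f e (iter t f x) >].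
have [[t Pt]|no] := pselect (exists t, P t); last first.
  right; exists (nseq k.+1 0%N); split; first by rewrite size_nseq.
    by apply/allP => t /nseqP[->].
  move=> i ni Ji; exists 0%N; rewrite ?mem_head //= add0n ltnNge; apply/negP => h.
  by apply: no; exists i; apply/asboolP; rewrite h.
case: (ex_minnP (ex_intro _ t Pt)) => {Pt}t /asboolP[/andP[Mt tn] Jt] tmin.
have [|sj|[ts [szts allts H]]] := IH (iter t f x) (n - t)%N; first by rewrite subn_gt0.
  by left; exists t.
right; exists (t :: map (addn t) ts); split; first by rewrite /= size_map szts.
  rewrite /= tn; apply/allP => _ /mapP[u uts ->].
  by have := allP allts _ uts; rewrite ltn_subRL.
move=> i ni Ji; have [it|ti] := ltnP i t.
  exists 0%N; rewrite ?mem_head //= add0n ltnNge; apply/negP => h.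
  by move: it; rewrite ltnNge => /negP; apply; apply: tmin; apply/asboolP; rewrite h.
have [||u uts hu] := H (i - t)%N.
- by rewrite ltn_sub2r // (leq_ltn_trans ti).
- by rewrite -iterD subnK.
exists (t + u)%N; last by move: hu; lia.
move: uts; rewrite inE => /predU1P[->|uts]; first by rewrite addn0 inE mem_head orbT.
by rewrite !inE (map_f (addn t) uts) !orbT.
Qed.

Definition bits cs x : (size cs).-tuple bool := map_tuple (fun c => x <= c) (in_tuple cs).

Lemma eq_bits cs x y : bits cs x = bits cs y <-> {in cs, forall c, (x <= c) = (y <= c)}.
Proof.
split=> [/(congr1 val) /= /eq_in_map //|H].
by apply: val_inj => /=; apply/eq_in_map.
Qed.

Lemma leq_card_code (T : eqType) (C : finType) (u : seq T) (h : T -> C) : uniq u ->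
  {in u &, injective h} -> (size u <= #|C|)%N.
Proof.
move=> uu hinj; rewrite -(size_map h); have := max_card (mem (map h u)).
by rewrite (card_uniqP _) // map_inj_in_uniq.
Qed.

(* An orbit is coded by k times around which its large jumps cluster and by its
   position with respect to finitely many cuts during bounded windows after
   these times. Crossing a cut requires a large jump, so between the windows
   the position does not change. *)
Theorem no_chain_poly_bound f k : aperiodic f -> ~ has_chain f k.+1 -> poly_bound f k.
Proof.
move=> tf nochain e e0; have [cf fr fp] := tf.
have [cs [Hcs [d d0 Hd]]] := separating_cuts cf e0.
have [M HM] := spaced_jumps_has_chain tf d0.
(* Time 0 always opens a window, so only k times vary. A window has M + 1 entries, because a jump at
   its last time [t + M - 1] changes the position at time [t + M]. *)
pose C (n : nat) : finType := (k.-tuple 'I_n * {ffun 'I_k.+1 * 'I_M.+1 -> (size cs).-tuple bool})%type.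
exists #|{ffun 'I_k.+1 * 'I_M.+1 -> (size cs).-tuple bool}| => n s n0 [us s01 ss].
have -> : (#|{ffun 'I_k.+1 * 'I_M.+1 -> (size cs).-tuple bool}| * n ^ k)%N = #|C n|.
  by rewrite /C card_prod card_tuple card_ord mulnC.
have /choice[T HT] : forall x, exists ts : k.-tuple 'I_n, 0 <= x <= 1 ->
    forall i, (i < n)%N -> jump f d (iter i f x) ->
      exists2 t, t \in 0%N :: map val ts & (t <= i < t + M)%N.
  move=> x; have [x01|] := boolP (0 <= x <= 1); last first.
    by exists [tuple of nseq k (Ordinal n0)].
  have [sj|[ts [szts allts H]]] := @jump_windows f d M k x n n0.
    by case: nochain; apply: HM sj.
  have szt : size (map (insubd (Ordinal n0)) ts) == k by rewrite size_map szts.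
  exists (Tuple szt) => _ /=; suff -> : [seq val i | i <- [seq insubd (Ordinal n0) i | i <- ts]] = ts by [].
  rewrite -map_comp; apply: map_id_in => t tts /=.
  by rewrite val_insubd (allP allts _ tts).
pose code x : C n := (T x, [ffun lo : 'I_k.+1 * 'I_M.+1 =>
  bits cs (iter (nth 0%N (0%N :: map val (T x)) lo.1 + lo.2) f x)]).
apply: (@leq_card_code _ _ s code us) => x y xs ys [ET Ebits].
apply/eqP; apply: contraT => xy.
have [i ni] := ss x y xs ys xy; rewrite ltNge => /negP[].
have win t o : t \in 0%N :: map val (T x) -> (o <= M)%N ->
    bits cs (iter (t + o) f x) = bits cs (iter (t + o) f y).
  move=> tT oM; have it : (index t (0%N :: map val (T x)) < k.+1)%N.
    by rewrite -[X in (_ < X)%N](_ : size (0%N :: map val (T x)) = _) ?index_mem //= size_map size_tuple.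
  have := congr1 (fun F : {ffun _ -> _} => F (Ordinal it, Ordinal (oM : (o < M.+1)%N))) Ebits.
  by rewrite !ffunE -ET /= -[nth _ _ _]/(nth 0%N (0%N :: map val (T x)) _) nth_index.
have same j : (j < n)%N -> bits cs (iter j f x) = bits cs (iter j f y).
  elim: j => [_|j IH jn]; first by apply: (win 0%N 0%N); rewrite ?mem_head.
  have [[t tT tj]|no] := pselect (exists2 t, t \in 0%N :: map val (T x) & (t <= j.+1 <= t + M)%N).
    have := win t (j.+1 - t)%N tT; rewrite subnKC; last by case/andP: tj.
    by apply; rewrite leq_subLR; case/andP: tj.
  have keep u : 0 <= u <= 1 -> T u = T x -> bits cs (iter j.+1 f u) = bits cs (iter j f u).
    move=> u01 ETu; apply/eq_bits => c ccs; apply/eqP; apply: contraT; rewrite eq_sym.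
    move=> /(Hd _ _ ccs) Ju; case: no.
    have [t] := HT u u01 j (ltnW jn) Ju; rewrite ETu => tT tj.
    by exists t => //; case/andP: tj => h1 h2; rewrite (leqW h1).
  rewrite (keep x) ?(keep y) ?s01 //; exact: IH (ltnW jn).
have /eq_bits Hb := same i ni.
have x01 := orbit01 i tf (s01 x xs); have y01 := orbit01 i tf (s01 y ys).
rewrite leNgt; apply/negP => far.
have [h|h] := leP (iter i f x) (iter i f y).
  have [|||c ccs hc] := Hcs (iter i f x) (iter i f y); [lra|lra| |].
    by move: far; rewrite ler0_norm ?subr_le0 //; lra.
  by have := Hb c ccs; case: leP => // ?; case: leP => // ?; lra.
have [|||c ccs hc] := Hcs (iter i f y) (iter i f x); [lra|lra| |].
  by move: far; rewrite gtr0_norm ?subr_gt0 //; lra.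
by have := Hb c ccs; case: leP => // ?; case: leP => // ?; lra.
Qed.

End Coding.

(** * Periodic orbits *)

Section Periods.
Context {R : realType}.
Implicit Types (f g : R -> R) (a b c x y z xl xr : R).

Definition self_map f := continuous f /\ forall x, 0 <= f x <= 1.

Definition least_period f p x := [/\ (0 < p)%N, iter p f x = x &
  forall k, (0 < k < p)%N -> iter k f x <> x].

Lemma periodsP f p : periods f p <-> exists2 x, 0 <= x <= 1 & least_period f p x.
Proof.
split=> [[p0 [x x01 [fx H]]]|[x x01 [p0 fx H]]].
  by exists x => //; move: x01; rewrite in_itv.
by split => //; exists x => //; rewrite in_itv.
Qed.

Lemma iter_period f p x n : iter p f x = x -> iter (n * p) f x = x.
Proof. by move=> fx; rewrite -iter_iter; apply: iter_fix. Qed.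

Lemma iter_modn f p x k : iter p f x = x -> iter k f x = iter (k %% p) f x.
Proof. by move=> fx; rewrite {1}(divn_eq k p) addnC iterD iter_period. Qed.

Lemma least_period_dvdn f p x k : least_period f p x -> iter k f x = x -> (p %| k)%N.
Proof.
move=> [p0 fx H]; rewrite (iter_modn k fx) => E; apply: contraPT E => nd.
by apply: H; rewrite ltn_mod p0 andbT lt0n.
Qed.

Lemma exists_least_period f p x : (0 < p)%N -> iter p f x = x ->
  exists2 q, least_period f q x & (q %| p)%N.
Proof.
move=> p0 fx; pose P q := (0 < q)%N && (iter q f x == x).
have exP : exists q, P q by exists p; rewrite /P p0 fx eqxx.
case: (ex_minnP exP) => q /andP[q0 /eqP fq] qmin.
have lq : least_period f q x.
  split=> // k /andP[k0 kq] fk; move: kq; rewrite ltnNge => /negP; apply.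
  by apply: qmin; rewrite /P k0 fk eqxx.
by exists q => //; apply: least_period_dvdn fx.
Qed.

Lemma periodic01 f p x : self_map f -> (0 < p)%N -> iter p f x = x -> 0 <= x <= 1.
Proof. by move=> [_ fr]; case: p => // p _ <-; apply: fr. Qed.

Lemma aperiodic_iter f m : self_map f -> (0 < m)%N ->
  (forall q, periods f q -> (q %| m)%N) -> aperiodic (iter m f).
Proof.
move=> sf m0 H; have [cf fr] := sf; split.
- exact: continuous_iter.
- by case: m m0 {H} => // m _ x; apply: fr.
- move=> x n n0; rewrite iter_iter => fx.
  have nm0 : (0 < n * m)%N by rewrite muln_gt0 n0.
  have [q lq _] := exists_least_period nm0 fx.
  have /H/dvdnP[k ->] : periods f q.
    by apply/periodsP; exists x => //; exact: periodic01 fx.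
  by apply: iter_period; case: lq.
Qed.

Lemma unif_cont_iter f (e : R) m : continuous f -> 0 < e -> exists2 r : R, 0 < r &
  forall x y, 0 <= x <= 1 -> 0 <= y <= 1 -> `|x - y| < r ->
    forall i, (i < m)%N -> `|iter i f x - iter i f y| < e.
Proof.
move=> cf e0; elim: m => [|m [r r0 H]]; first by exists 1.
have [r' r'0 H'] := unif_cont (@continuous_iter _ f m cf) e0.
exists (Num.min r r') => [|x y x01 y01]; first by rewrite lt_min r0.
rewrite lt_min => /andP[h h'] i; rewrite ltnS leq_eqVlt => /predU1P[->|]; last exact: H.
exact: H'.
Qed.

(** By uniform continuity, orbits more than e apart at time i are more than [r / 2] apart at the
    last multiple of m up to i. Halving r makes up for the weak inequality in the negation. *)
Lemma poly_bound_iter f m k : self_map f -> (0 < m)%N ->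
  poly_bound (iter m f) k -> poly_bound f k.
Proof.
move=> [cf fr] m0 H e e0; have [r r0 Hr] := unif_cont_iter m cf e0.
have r2 : 0 < r / 2 by lra.
have [C HC] := H _ r2; exists C => n s n0 [us s01 ss]; apply: HC => //.
split => // x y xs ys xy; have [i ni hi] := ss x y xs ys xy.
exists (i %/ m)%N; first exact: leq_ltn_trans (leq_div _ _) ni.
rewrite ltNge !iter_iter; apply/negP => h.
have b01 z n' : 0 <= z <= 1 -> 0 <= iter n' f z <= 1 by case: n' => // n' _; apply: fr.
have := Hr _ _ (b01 _ (i %/ m * m)%N (s01 _ xs)) (b01 _ (i %/ m * m)%N (s01 _ ys)).
have im : (i %% m < m)%N by rewrite ltn_mod.
move=> /(_ _) H'; have /H' /(_ _ im) : `|iter (i %/ m * m) f x - iter (i %/ m * m) f y| < r by lra.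
by rewrite -!iterD addnC -divn_eq ltNge (ltW hi).
Qed.

Lemma has_chain_oo f : (forall k, has_chain f k) -> h_pol f = +oo%E.
Proof.
move=> all; apply/eqyP => A _.
have := has_chain_h_pol (all (Num.truncn A).+1); apply: le_trans.
by rewrite lee_fin ltW // truncnS_gt.
Qed.

(** The maximality of k is kept in the conclusion because the lower bound for type [2 ^ n] is
    obtained from a chain. *)
Lemma rigidity f m : self_map f -> (0 < m)%N -> (forall q, periods f q -> (q %| m)%N) ->
  (exists2 k, h_pol f = k%:R%:E & forall j, has_chain f j -> (j <= k)%N) \/ h_pol f = +oo%E.
Proof.
move=> sf m0 H.
have [all|] := pselect (forall k, has_chain f k).
  by right; apply: has_chain_oo.
move=> /existsNP[k0 nk0]; left.
have exP : exists k, `[< ~ has_chain f k >] by exists k0; apply/asboolP.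
case: (ex_minnP exP) => -[|k] /asboolP nk kmin.
  case: nk; exists 1%N => //; exists 0, 1; do !split; lra.
have hk : has_chain f k.
  by apply: contrapT => h; have := kmin k (asboolT h); rewrite ltnn.
exists k.
  apply/eqP; rewrite eq_le has_chain_h_pol // andbT.
  apply: h_pol_le; apply: (poly_bound_iter sf m0).
  apply: no_chain_poly_bound; first exact: aperiodic_iter.
  by move=> /(has_chain_iter m0).
move=> j hj; rewrite leqNgt; apply/negP => kj; apply: nk.
exact: has_chain_le hj.
Qed.

(* The largest point of a cycle that moves up, and the next point of the cycle,
   form such a pair. *)
Definition central f p xl xr := [/\ (0 < p)%N, iter p f xl = xl, xl < xr &
  [/\ exists r, xr = iter r f xl, forall i, iter i f xl <= xl \/ xr <= iter i f xl,
    xr <= f xl & f xr <= xl]].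

Lemma iter_back f p x l : (0 < p)%N -> iter p f x = x ->
  iter (p * l - l) f (iter l f x) = x.
Proof.
by move=> p0 fx; rewrite -iterD subnK ?leq_pmull // mulnC iter_period.
Qed.

Lemma exists_central f p x : (1 < p)%N -> least_period f p x ->
  exists l xr, central f p (iter l f x) xr /\ least_period f p (iter l f x).
Proof.
move=> p1 lp; have [p0 fx H] := lp.
pose O i := iter i f x.
have Omod i : O i = O (i %% p)%N by exact: (iter_modn i fx).
have nfix i : O i.+1 != O i.
  apply/eqP => /= E; have := iter_back i p0 fx; rewrite (iter_fix _ E) => E'.
  by apply: (H 1%N); rewrite ?p1 //= -E' E.
pose i0 := Ordinal p0.
case: (@arg_minP _ _ 'I_p i0 xpredT (fun i => O i) isT) => imin _ Hmin.
pose U := fun i : 'I_p => O i < O i.+1.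
have Umin : U imin.
  rewrite /U lt_neqAle eq_sym nfix /= Omod.
  have im : (imin.+1 %% p < p)%N by rewrite ltn_mod.
  have := Hmin (Ordinal im) isT; rewrite /= -Omod => h.
  by rewrite -(Omod imin).
case: (@arg_maxP _ _ 'I_p imin U (fun i => O i) Umin) => l Ul Hl.
have im : (l.+1 %% p < p)%N by rewrite ltn_mod.
pose V := fun i : 'I_p => O l < O i.
have Vl : V (Ordinal im) by rewrite /V /= -Omod.
case: (@arg_minP _ _ 'I_p (Ordinal im) V (fun i => O i) Vl) => r Vr Hr.
have dich i : O i <= O l \/ O r <= O i.
  have [h|h] := leP (O i) (O l); [by left|right].
  have ip : (i %% p < p)%N by rewrite ltn_mod.
  by have := Hr (Ordinal ip); rewrite /V /= -Omod; apply.
have lpl : least_period f p (O l).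
  split=> // [|k kp]; first by rewrite /O -iterD addnC iterD fx.
  rewrite /O -iterD addnC iterD => E; apply: (H k kp).
  have := congr1 (iter (p * l - l) f) E; rewrite !iter_back //.
  by rewrite -iterD addnC iterD fx.
exists l, (O r); split => //; split => //; first by case: lpl.
have orb i : iter i f (iter l f x) = O (i + l)%N by rewrite /O iterD.
split.
- exists (r + (p * l - l))%N; rewrite orb -addnA subnK ?leq_pmull //.
  by rewrite (Omod r) (Omod (r + _)%N) mulnC addnC modnMDl.
- by move=> i; rewrite orb; apply: dich.
- by have [] := dich l.+1 => //; move: (Ul : U l); rewrite /U /O /=; lra.
- have := dich r.+1; case=> // h.
  have Ur : U r by rewrite /U lt_neqAle eq_sym nfix h.
  by move: Vr; rewrite /V ltNge; have -> : O r <= O l by apply: Hl.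
Qed.

Lemma central_mirror f p xl xr : central f p xl xr -> central (mirror f) p (1 - xr) (1 - xl).
Proof.
move=> [p0 fx lr [[r rE] dich fl fr]].
have fxr : iter p f xr = xr by rewrite rE -iterD addnC iterD fx.
split => //; first by rewrite iter_mirror subKr fxr.
  lra.
split.
- by exists (p * r - r)%N; rewrite iter_mirror subKr rE iter_back.
- move=> i; rewrite iter_mirror subKr rE -iterD.
  by have := dich (i + r)%N; rewrite rE; case; [right|left]; lra.
- by rewrite /mirror subKr; lra.
- by rewrite /mirror subKr; lra.
Qed.

(** Since [xl, xr] covers itself, xl has a preimage in it under every iterate; so for [N >= p] the
    image under [iter N f] contains the whole cycle. *)
Lemma central_covers f p xl xr N i j : continuous f -> central f p xl xr -> (p <= N)%N ->
  covers (iter N f) xl xr (iter i f xl) (iter j f xl).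
Proof.
move=> cf [p0 fx lr [_ _ fl fr]] pN.
have cJ : covers f xl xr xl xr by apply: (@covers_ivt _ _ _ _ _ _ xr xl) => //; lra.
have pre k : exists2 u, xl <= u <= xr & iter N f u = iter k f xl.
  have kN : (k %% p <= N)%N by apply: leq_trans pN; apply: ltnW; rewrite ltn_mod.
  have [|u ub E] := covers_self_iter (N - k %% p) cJ (y := xl); first lra.
  exists u => //; rewrite (iter_modn k fx) -E -iterD subnKC //.
have [u ub Eu] := pre i; have [v vb Ev] := pre j.
apply: (covers_ivt _ ub vb); rewrite ?Eu ?Ev //; exact: continuous_iter.
Qed.

(* c is the last point before xl that is mapped to xl. *)
Lemma switch_interval f p xl xr i : continuous f -> central f p xl xr ->
  iter i f xl <= xl -> f (iter i f xl) <= xl -> exists c,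
  [/\ iter i f xl <= c, c < xl, covers f c xl xl xr & forall t, c <= t <= xl -> f t != t].
Proof.
move=> cf [p0 fx lr [_ _ fl fr]]; set y := iter i f xl => yl fy.
(* The solutions of [f t = xl] are the fixed points of this map, so [last_fixpoint] yields the last
   one. *)
have cG : continuous (fun t => f t - xl + t).
  move=> t; apply: (@cvgD _ _ _ _ _ (fun t => f t - xl) id); last exact: cvg_id.
  by apply: continuousB; [exact: cf|exact: cvg_cst].
have [|c0 c0b fc0] := ivt cf yl (v := xl); first by left; lra.
have [||c [fc cb nc]] := @last_fixpoint _ (fun t => f t - xl + t) c0 xl cG; try lra.
have fcE : f c = xl by lra.
have cl : c < xl.
  rewrite lt_neqAle; apply/andP; split; last lra.
  by apply/eqP => cE; move: fl; rewrite -{1}cE fcE; lra.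
exists c; split => //; first lra.
  by apply: (@covers_ivt _ _ _ _ _ _ c xl) => //; lra.
move=> t tb; apply/eqP => ft.
have tl : t < xl.
  rewrite lt_neqAle; apply/andP; split; last lra.
  by apply/eqP => tE; move: fl; rewrite -tE ft; lra.
have [E|tc] := eqVneq t c; first by move: ft; rewrite E fcE; lra.
have ct : c < t by rewrite lt_neqAle eq_sym tc /=; lra.
have [|d db fd] := ivt cf (ltW tl) (v := xl); first by left; lra.
have /eqP[] : f d - xl + d != d by apply: nc; lra.
by rewrite fd subrr add0r.
Qed.

Lemma covers_fixpoint g a b : continuous g -> a <= b -> covers g a b a b ->
  exists2 t, a <= t <= b & g t = t.
Proof.
move=> cg ab cov.
have [|s sb gs] := cov a; first lra.
have [|t tb gt] := cov b; first lra.
have [st|ts] := leP s t.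
  by have [|c cb gc] := fixpoint_between cg st; [left; lra|exists c => //; lra].
by have [|c cb gc] := fixpoint_between cg (ltW ts); [right; lra|exists c => //; lra].
Qed.

(** The interval [c, xl] contains no fixed point of f, yet f maps it over [xl, xr], which [iter N f]
    maps over the whole cycle and so over [c, xl]. *)
Lemma nonswitch_fixpoint f p xl xr i N : continuous f -> central f p xl xr ->
  iter i f xl <= xl -> f (iter i f xl) <= xl -> (p <= N)%N ->
  exists2 t, iter N.+1 f t = t & f t <> t.
Proof.
move=> cf cen h1 h2 pN.
have [c [yc cl cov nf]] := switch_interval cf cen h1 h2.
have [|||t tb ft] := @covers_fixpoint (iter N.+1 f) c xl.
- exact: continuous_iter.
- exact: ltW.
- have := covers_iterD (n := 1) cov (@central_covers f p xl xr N i 0 cf cen pN).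
  by rewrite addn1; apply: covers_sub.
by exists t => //; apply/eqP/nf.
Qed.

Definition pow2_periods f := forall q, periods f q -> exists n, q = (2 ^ n)%N.

Lemma prime_period_contra f t q : self_map f -> pow2_periods f -> prime q -> odd q ->
  iter q f t = t -> f t <> t -> False.
Proof.
move=> sf pf pq oq ft nft; have q0 := prime_gt0 pq.
have [d ld] := exists_least_period q0 ft.
case/primeP: (pq) => _ H /H /orP[] /eqP dE.
  by apply: nft; move: ld; rewrite dE => -[].
have [|a qE] := pf q.
  by apply/periodsP; exists t; [exact: periodic01 ft|rewrite -dE].
by move: oq pq; rewrite qE oddX; case: a {qE}.
Qed.

(* If two consecutive points of the orbit lay on the same side, there would be
   points of every large prime period. *)
Lemma pow2_switch f p xl xr i : self_map f -> pow2_periods f -> central f p xl xr ->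
  iter i.*2 f xl <= xl /\ xr <= iter i.*2.+1 f xl.
Proof.
move=> sf pf cen; have [cf fr] := sf.
(* Such a prime is odd and leaves [q - 1 >= p] steps, enough to cover the whole cycle. *)
have [q pq1 pq] := prime_above (p + 3).
have oq : odd q.
  by case: (even_prime pq) => // q2; move: pq1; rewrite q2 addn3.
have qE : q.-1.+1 = q by rewrite prednK // prime_gt0.
have pN : (p <= q.-1)%N by rewrite -ltnS qE; apply: leq_ltn_trans pq1; apply: leq_addr.
have [p0 fx lr [[r rE] dich fl fxr]] := cen.
have swl j : iter j f xl <= xl -> xr <= f (iter j f xl).
  move=> h; have [//h'|//] := dich j.+1; exfalso.
  have [t] := nonswitch_fixpoint cf cen h h' pN; rewrite qE.
  exact: prime_period_contra.
have swr j : xr <= iter j f xl -> f (iter j f xl) <= xl.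
  move=> h; have [//|h'] := dich j.+1; exfalso.
  have cen' := central_mirror cen.
  (* The shift by [p * r - r] leads from [xr = iter r f xl] back to xl. *)
  have E k : iter (k + (p * r - r)) (mirror f) (1 - xr) = 1 - iter k f xl.
    by rewrite iter_mirror subKr iterD rE iter_back.
  have [||t ft nft] := nonswitch_fixpoint (i := (j + (p * r - r))%N) (mirror_cont cf) cen' _ _ pN.
  - by rewrite E; lra.
  - by rewrite E /mirror subKr; move: h' => /=; lra.
  apply: (prime_period_contra sf pf pq oq (t := 1 - t)).
  + by rewrite qE in ft; move: ft; rewrite iter_mirror; lra.
  + by move=> h2; apply: nft; apply/mirror_fix.
elim: i => [|i [IH1 IH2]]; first by split => //; exact: (swl 0%N).
have h1 : iter i.+1.*2 f xl <= xl by rewrite doubleS; apply: (swr i.*2.+1).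
by split => //; exact: (swl i.+1.*2).
Qed.

End Periods.

(** * Chains from periodic orbits *)

Section ChainsFromPeriods.
Context {R : realType}.
Implicit Types (f g : R -> R) (a b c x y z xl xr : R).

Lemma pow2_periods_sqr f : self_map f -> pow2_periods f -> pow2_periods (iter 2 f).
Proof.
move=> sf pf q /periodsP[x x01 lq]; have [q0 fx _] := lq.
rewrite iter_iter in fx.
have [|d ld _] := exists_least_period _ fx; first by rewrite muln_gt0 q0.
have [|n dE] := pf d; first by apply/periodsP; exists x.
have : iter d (iter 2 f) x = x by rewrite iter_iter mulnC iter_period //; case: ld.
move/(least_period_dvdn lq); rewrite dE => /(dvdn_pfactor _ _ (isT : prime 2))[m _ ->].
by exists m.
Qed.

(* The chain starts with the interval between the largest point xl of the left
   half of the orbit and a fixed point z, and goes on with a chain for f^2 on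
   the left half, which is an orbit of f^2 of half the period. *)
Lemma pow2_chain n f x : self_map f -> pow2_periods f -> least_period f (2 ^ n.+1) x ->
  exists N a b, [/\ (0 < N)%N, chain (iter N f) n a b,
    exists i, iter i f x <= a & exists i, b < iter i f x].
Proof.
elim: n f x => [|n IH] f x sf pf lp; have [cf fr] := sf;
  have [|l [xr [cen lpl]]] := exists_central _ lp; rewrite ?expnS ?expn_gt0 //.
- set xl := iter l f x in cen lpl.
  have [p0 fx lr [[r rE] _ _ _]] := cen.
  have xl01 := periodic01 sf p0 fx.
  exists 1%N, xl, xl; split => //; first by do !split; lra.
    by exists l.
  by exists (r + l)%N; rewrite iterD -/xl -rE.
- by rewrite leq_pmulr // ?muln_gt0 ?expn_gt0.
- set xl := iter l f x in cen lpl.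
  have [p0 fx lr [[r rE] dich fl fxr]] := cen.
  have xl01 := periodic01 sf p0 fx.
  have sw i := (pow2_switch i sf pf cen).1.
  have sg : self_map (iter 2 f) by split; [exact: continuous_iter|move=> ?; apply: fr].
  have lpg : least_period (iter 2 f) (2 ^ n.+1) xl.
    split; first by rewrite expn_gt0.
      by rewrite iter_iter mulnC -expnS.
    move=> k /andP[k0 kn]; rewrite iter_iter; case: lpl => _ _; apply.
    by rewrite muln_gt0 k0 /= mulnC expnS ltn_mul2l.
  (* The bounds by orbit points in the induction hypothesis place the chain of [iter 2 f] below xl,
     hence apart from [xl, z], and its start within reach of xl. *)
  have [N [a [b [N0 Hc [i ia] [j jb]]]]] := IH _ _ sg (pow2_periods_sqr sf pf) lpg.
  have [|z zb fz] := fixpoint_between cf (ltW lr); first by right; lra.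
  have xlz : xl < z.
    rewrite lt_neqAle; apply/andP; split; last lra.
    by apply/eqP => zE; move: fl; rewrite zE fz -zE; lra.
  have zxr : z < xr.
    rewrite lt_neqAle; apply/andP; split; last lra.
    by apply/eqP => zE; move: fxr; rewrite -zE fz; lra.
  have bxl : b < xl.
    by apply: (lt_le_trans jb); rewrite iter_iter muln2; apply: sw.
  have cg : continuous (iter 2 f) by case: sg.
  have cov : covers (iter 2 f) xl z xl z.
    apply: (@covers_ivt _ _ _ _ _ _ xl z) => //; try lra; first exact: (sw 1%N).
    by rewrite iter_fix.
  have [a0 ab b1] := chain_bounds Hc.
  (* A multiple of N that is at least i: after waiting [M - i] steps in [xl, z], i steps lead from
     xl to a point that is at most a. *)
  pose M := (i.+1 * N)%N.
  have iM : (i <= M)%N by rewrite /M; apply: leq_trans (leqnSn i) _; rewrite leq_pmulr.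
  have M0 : (0 < M)%N by rewrite muln_gt0.
  have xr01 : 0 <= xr <= 1.
    by rewrite rE; case: (r) => [//|k]; apply: fr.
  exists (M * 2)%N, xl, z; split; first by rewrite muln_gt0 M0.
  + have -> : iter (M * 2) f = iter M (iter 2 f) by apply/funext => u; rewrite iter_iter.
    do !split; try lra; first exact: covers_self_iter.
    exists a, b; split; last 2 first.
    * by right.
    * exact: chain_iterM.
    * have [|u ub E] := covers_self_iter (M - i) cov (y := xl); first lra.
      apply: (@covers_ivt _ _ _ _ _ _ u z) => //; try lra.
      - exact: continuous_iter.
      - by rewrite -(subnKC iM) iterD E.
      - by rewrite !iter_fix //; lra.
  + by exists l.
  + by exists (r + l)%N; rewrite iterD -/xl -rE.
Qed.

Lemma chain_mirror f N k a b : chain (iter N (mirror f)) k a b ->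
  chain (iter N f) k (1 - b) (1 - a).
Proof.
elim: k a b => [|k IH] a b /=; first by move=> [? [? [? _]]]; do !split; lra.
move=> [a0 [ab [b1 [cab [c [d [ccd dis /IH Hc]]]]]]].
do !split; try lra; first exact: covers_mirror.
exists (1 - d), (1 - c); split => //; first exact: covers_mirror.
by case: dis; [right|left]; lra.
Qed.

Lemma has_chain_mirror f k : has_chain (mirror f) k -> has_chain f k.
Proof. by move=> [N N0 [a [b /chain_mirror H]]]; exists N => //; exists (1 - b), (1 - a). Qed.

(* Some iterate of f maps both [z, xr] and [c, xl], which are disjoint, onto an
   interval containing both; the chain alternates between them. *)
Lemma odd_horseshoe_left f p xl xr i k : self_map f -> central f p xl xr -> odd p ->
  iter i f xl <= xl -> f (iter i f xl) <= xl -> has_chain f k.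
Proof.
move=> sf cen op h1 h2; have [cf fr] := sf.
have [c [yc cl covK _]] := switch_interval cf cen h1 h2.
have [p0 fx lr [[r rE] dich fl fxr]] := cen.
have [|z zb fz] := fixpoint_between cf (ltW lr); first by right; lra.
have xlz : xl < z.
  rewrite lt_neqAle; apply/andP; split; last lra.
  by apply/eqP => zE; move: fl; rewrite zE fz -zE; lra.
have fxr' : iter p f xr = xr by rewrite rE -iterD addnC iterD fx.
have xl01 := periodic01 sf p0 fx; have xr01 := periodic01 sf p0 fxr'.
have y01 : 0 <= iter i f xl by case: (i) => [|m]; [case/andP: xl01|case/andP: (fr (iter m f xl))].
set y := iter i f xl in h1 h2 yc y01.
(* As p is odd, adding p to a time changes its parity but not the point. An even time is wanted
   because [z, xr] covers itself under [iter 2 f]. *)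
have [j ej yE] : exists2 j, ~~ odd j & iter j f xr = y.
  pose j0 := (i + (p * r - r))%N.
  have yj0 : iter j0 f xr = y by rewrite iterD rE iter_back.
  have [oj|] := boolP (odd j0); last by exists j0.
  by exists (j0 + p)%N; [rewrite oddD oj op|rewrite iterD fxr'].
pose M := (j + p.*2)%N.
have covA2 : covers (iter 2 f) z xr z xr.
  have c1 : covers f z xr xl z by apply: (@covers_ivt _ _ _ _ _ _ xr z) => //; lra.
  have c2 : covers f xl z z xr by apply: (@covers_ivt _ _ _ _ _ _ z xl) => //; lra.
  exact: (@covers_iterD _ f 1 1 _ _ _ _ _ _ c1 c2).
have even_cov m : ~~ odd m -> covers (iter m f) z xr z xr.
  move=> em; have -> : iter m f = iter m./2 (iter 2 f).
    by apply/funext => u; rewrite iter_iter muln2 even_halfK.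
  exact: covers_self_iter.
have pM : (p < M)%N by rewrite /M -addnn addnA -{1}[p]add0n ltn_add2r addn_gt0 p0 orbT.
have M0 : (0 < M)%N by apply: leq_ltn_trans pM.
have eM : ~~ odd M by rewrite /M oddD odd_double addbF.
have covA : covers (iter M f) z xr y xr.
  have [|u ub E] := even_cov p.*2 (negbT (odd_double p)) xr; first lra.
  have [|v vb E'] := even_cov M eM xr; first lra.
  apply: (@covers_ivt _ _ _ _ _ _ u v) => //; first exact: continuous_iter.
    by rewrite /M iterD E yE.
  by rewrite E'.
have covK' : covers (iter M f) c xl y xr.
  have pM' : (p <= M.-1)%N by rewrite -ltnS prednK.
  have := covers_iterD (n := 1) covK (@central_covers _ f p xl xr M.-1 i r cf cen pM').
  by rewrite addn1 prednK // -rE.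
exists M => //.
suff : forall k, chain (iter M f) k z xr /\ chain (iter M f) k c xl.
  by move=> /(_ k)[H _]; exists z, xr.
elim=> [|m [IH1 IH2]]; first by do !split; lra.
split.
- do !split; try lra; first by apply: covers_sub covA; lra.
  exists c, xl; split => //; last by right.
  by apply: covers_sub covA; lra.
- do !split; try lra; first by apply: covers_sub covK'; lra.
  exists z, xr; split => //; last by left.
  by apply: covers_sub covK'; lra.
Qed.

(** An odd cycle cannot be exchanged by halves: at the odd time p the point is back at xl instead of
    on the right. So two consecutive points lie on one side, up to reflection on the left. *)
Lemma odd_horseshoe f p x k : self_map f -> least_period f p x -> odd p -> (1 < p)%N ->
  has_chain f k.
Proof.
move=> sf lp op p1; have [l [xr [cen _]]] := exists_central p1 lp.
set xl := iter l f x in cen; have [p0 fx lr [[r rE] dich fl fxr]] := cen.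
have [sw|] := pselect (forall i, iter i f xl <= xl -> xr <= f (iter i f xl)); last first.
  move=> /existsNP[i /not_implyP[h /negP]]; rewrite -ltNge => h'.
  apply: (odd_horseshoe_left k sf cen op h).
  by have [//|] := dich i.+1; rewrite /=; lra.
have [sw'|] := pselect (forall i, xr <= iter i f xl -> f (iter i f xl) <= xl); last first.
  move=> /existsNP[i /not_implyP[h /negP]]; rewrite -ltNge => h'.
  have [//|h2] := dich i.+1; first by rewrite /=; lra.
  apply: has_chain_mirror.
  have E j : iter (j + (p * r - r)) (mirror f) (1 - xr) = 1 - iter j f xl.
    by rewrite iter_mirror subKr iterD rE iter_back.
  have smf : self_map (mirror f).
    case: sf => cf fr'; split; first exact: mirror_cont.
    by move=> u; have := fr' (1 - u); rewrite /mirror; lra.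
  apply: (odd_horseshoe_left k smf (central_mirror cen) op (i := (i + (p * r - r))%N)).
    by rewrite E; lra.
  by rewrite E /mirror subKr; move: h2 => /=; lra.
exfalso.
have H i : iter i.*2 f xl <= xl /\ xr <= iter i.*2.+1 f xl.
  elim: i => [|i [IH1 IH2]]; first by split => //; exact: (sw 0%N).
  have h1 : iter i.+1.*2 f xl <= xl by rewrite doubleS; apply: (sw' i.*2.+1).
  by split => //; exact: (sw i.+1.*2).
have [_] := H p./2; have := odd_double_half p; rewrite op add1n => ->.
by rewrite fx; lra.
Qed.

End ChainsFromPeriods.

(** * Examples *)

Section SeparatedBounds.
Context {R : realType}.
Implicit Types (f g : R -> R) (s : seq R) (x y z : R) (U W : pred R).

Lemma separated_sub f n (e : R) s s' : uniq s' -> {subset s' <= s} ->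
  separated f n e s -> separated f n e s'.
Proof.
move=> us' sub [us s01 H]; split => // [x /sub|x y /sub xs /sub ys]; first exact: s01.
exact: H.
Qed.

Lemma size_le_fibers (T : Type) (s : seq T) (idx : T -> nat) C B :
  all (fun t => idx t < C)%N s ->
  (forall c, (c < C)%N -> (size (seq.filter (fun t => idx t == c) s) <= B)%N) ->
  (size s <= C * B)%N.
Proof.
elim: C s => [|C IH] s.
  by case: s.
move=> alls H; rewrite -(count_predC (fun t => idx t == C)) mulSn leq_add //.
  by rewrite -size_filter; apply: H.
rewrite -size_filter; apply: IH => [|c cC].
  rewrite all_filter; apply: sub_all alls => x /=; rewrite ltnS leq_eqVlt.
  by case: eqP.
apply: leq_trans (H c (leqW cC)); rewrite -filter_predI !size_filter.
by apply: sub_count => x /= /andP[].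
Qed.

Lemma unit_interval_grid (e : R) : 0 < e -> exists C (idx : R -> nat),
  (forall x, 0 <= x <= 1 -> (idx x < C)%N) /\
  (forall x y, 0 <= x <= 1 -> 0 <= y <= 1 -> idx x = idx y -> `|x - y| <= e).
Proof.
move=> e0; exists (Num.truncn e^-1).+1, (fun x => Num.truncn (x / e)); split.
  move=> x x01; rewrite ltnS; apply: le_truncn.
  by rewrite ler_pdivrMr // mulVf ?gt_eqF //; lra.
move=> x y x01 y01 E.
have x0 : 0 <= x / e by apply: divr_ge0; lra.
have y0 : 0 <= y / e by apply: divr_ge0; lra.
have := truncn_itv x0; have := truncn_itv y0; rewrite E -!natr1.
rewrite !ler_pdivlMr // !ltr_pdivrMr // mulrDl mul1r => /andP[h1 h2] /andP[h3 h4].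
by rewrite ler_norml; lra.
Qed.

Definition sep_bound f W k := forall e : R, 0 < e -> exists C, forall n s, (0 < n)%N ->
  separated f n e s -> all W s -> (size s <= C * n ^ k)%N.

Lemma sep_boundU f W W' k : sep_bound f W k -> sep_bound f W' k ->
  sep_bound f (predU W W') k.
Proof.
move=> H H' e e0; have [C HC] := H e e0; have [C' HC'] := H' e e0.
exists (C + C')%N => n s n0 sp alls.
rewrite -(count_predC W) -!size_filter mulnDl leq_add //.
- apply: HC => //; last exact: filter_all.
  by apply: (separated_sub _ _ sp); [case: sp => us _ _; exact: filter_uniq|exact: mem_subseq (filter_subseq _ _)].
- apply: HC' => //.
    by apply: (separated_sub _ _ sp); [case: sp => us _ _; exact: filter_uniq|exact: mem_subseq (filter_subseq _ _)].
  rewrite all_filter; apply: sub_all alls => x /= /orP[->|->]; last by rewrite implybT.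
  by [].
Qed.

Lemma sep_boundW f W W' k : (forall x, 0 <= x <= 1 -> W x -> W' x) ->
  sep_bound f W' k -> sep_bound f W k.
Proof.
move=> sub H e e0; have [C HC] := H e e0; exists C => n s n0 sp /allP alls.
by apply: HC => //; apply/allP => x xs; apply: sub; [case: sp => _ + _; apply|apply: alls].
Qed.

Lemma separated_image f n (e : R) s : separated f n.+1 e s ->
  (forall x, x \in s -> 0 <= f x <= 1) ->
  (forall x y, x \in s -> y \in s -> x != y ->
    e < `|x - y| -> (0 < n)%N /\ e < `|f x - f y|) ->
  0 < e -> separated f n e (map f s).
Proof.
move=> [us s01 H] f01 H0 e0.
have H' x y : x \in s -> y \in s -> x != y ->
    exists2 i, (i < n)%N & e < `|iter i f (f x) - iter i f (f y)|.
  move=> xs ys xy; have [[|i] ni h] := H x y xs ys xy.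
    by have [n0 h'] := H0 x y xs ys xy h; exists 0%N.
  by exists i => //; rewrite -!iterSr.
split.
- rewrite map_inj_in_uniq // => x y xs ys fxy; apply/eqP; apply: contraT => xy.
  have [i _] := H' x y xs ys xy; rewrite fxy subrr normr0; lra.
- by move=> _ /mapP[x xs ->]; apply: f01.
- move=> _ _ /mapP[x xs ->] /mapP[y ys ->] fxy; apply: H' => //.
  by apply: contraNneq fxy => ->.
Qed.

(** Points in one cell of a grid of mesh e are not separated at time 0, so f is injective on them
    and their images are separated. The number of cells is only a constant factor. *)
Lemma sep_bound_preim f W W' k : (forall x, 0 <= x <= 1 -> W x -> 0 <= f x <= 1 /\ W' (f x)) ->
  sep_bound f W' k -> sep_bound f W k.
Proof.
move=> fW H e e0; have [C HC] := H e e0; have [G [idx [G1 G2]]] := unit_interval_grid e0.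
exists (G * C)%N => n s n0 sp /allP alls; have [us s01 _] := sp.
rewrite -mulnA; apply: (@size_le_fibers _ _ idx).
  by apply/allP => x /s01 /G1.
move=> c cG; set t := seq.filter _ s.
have ts x : x \in t -> [/\ x \in s, idx x = c & 0 <= x <= 1].
  by rewrite mem_filter => /andP[/eqP ? xs]; split => //; apply: s01.
have spt : separated f n e t.
  by apply: (separated_sub _ _ sp); [exact: filter_uniq|move=> x /ts[]].
rewrite -(size_map f); apply: HC => //.
- apply: (@separated_leq _ _ n.-1 _ _ e) => //; first exact: leq_pred.
  apply: separated_image => //; first by rewrite prednK.
    by move=> x /ts[xs _ x01]; have [] := fW x x01 (alls _ xs).
  move=> x y /ts[_ ix x01] /ts[_ iy y01] _; rewrite ltNge G2 //.
  by rewrite ix iy.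
- by apply/allP => _ /mapP[x /ts[xs _ x01] ->]; have [] := fW x x01 (alls _ xs).
Qed.

Lemma size_le_discrete (e : R) : 0 < e -> exists C, forall s, uniq s ->
  (forall x, x \in s -> 0 <= x <= 1) ->
  (forall x y, x \in s -> y \in s -> x != y -> e < `|x - y|) -> (size s <= C)%N.
Proof.
move=> e0; have [G [idx [G1 G2]]] := unit_interval_grid e0; exists G => s us s01 H.
rewrite -[G]muln1; apply: (@size_le_fibers _ _ idx); first by apply/allP => x /s01 /G1.
move=> c _; case E: (seq.filter _ s) => [//|x [//|y t]]; exfalso.
have := mem_head x (y :: t); have yt : y \in [:: x, y & t] by rewrite !inE eqxx orbT.
have uxy : uniq [:: x, y & t] by rewrite -E filter_uniq.
move: yt; rewrite -E !mem_filter => /andP[/eqP iy ys] /andP[/eqP ix xs].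
have xy : x != y by move: uxy; rewrite /= inE negb_or => /andP[/andP[]].
have := H x y xs ys xy; rewrite ltNge => /negP; apply; apply: G2; try exact: s01.
by rewrite ix.
Qed.

(** As f does not shrink distances in U, the images of the points in U are separated by orbits one
    step shorter. Each of the n steps costs one bound for the points outside U, so the degree rises
    by one. *)
Lemma transient_bound f U k : (forall x, 0 <= x <= 1 -> 0 <= f x <= 1) ->
  (forall x y, 0 <= x <= 1 -> 0 <= y <= 1 -> U x -> U y -> `|x - y| <= `|f x - f y|) ->
  sep_bound f (predC U) k -> poly_bound f k.+1.
Proof.
move=> f01 expU H e e0; have [C HC] := H e e0; have [G HG] := size_le_discrete e0.
suff K n s : separated f n.+1 e s -> (size s <= C * n.+1 ^ k.+1 + G)%N.
  exists (C + G)%N => -[//|n] s _ /K h; apply: (leq_trans h).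
  by rewrite mulnDl leq_add2l leq_pmulr // expn_gt0.
elim: n s => [|n IH] s sp; have [us s01 ss] := sp.
  apply: leq_trans (leq_addl _ _); apply: HG => // x y xs ys xy.
  by have [i] := ss x y xs ys xy; case: i.
rewrite -(count_predC (predC U)) -!size_filter.
have h1 : (size (seq.filter (predC U) s) <= C * n.+2 ^ k)%N.
  apply: HC => //; last exact: filter_all.
  by apply: (separated_sub _ _ sp); [exact: filter_uniq|exact: mem_subseq (filter_subseq _ _)].
have h2 : (size (seq.filter (predC (predC U)) s) <= C * n.+1 ^ k.+1 + G)%N.
  rewrite -(size_map f); apply: IH; set t := seq.filter _ s.
  have ts x : x \in t -> [/\ x \in s, U x & 0 <= x <= 1].
    by rewrite mem_filter /= negbK => /andP[? xs]; split => //; apply: s01.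
  apply: separated_image => //.
  - by apply: (separated_sub _ _ sp); [exact: filter_uniq|move=> x /ts[]].
  - by move=> x /ts[_ _ /f01].
  - move=> x y /ts[_ Ux x01] /ts[_ Uy y01] _ h; split => //.
    exact: lt_le_trans h (expU _ _ x01 y01 Ux Uy).
apply: leq_trans (leq_add h1 h2) _; rewrite addnA leq_add2r -mulnDr leq_mul2l.
apply/orP; right; rewrite [in leqRHS]expnS mulSn leq_add2l expnS leq_mul2l /=.
by case: k {H HC IH h1 h2} => // k; rewrite leq_exp2r.
Qed.

Lemma isometry_bound f : (forall x y, 0 <= x <= 1 -> 0 <= y <= 1 -> `|f x - f y| = `|x - y|) ->
  (forall x, 0 <= x <= 1 -> 0 <= f x <= 1) -> poly_bound f 0.
Proof.
move=> iso f01 e e0; have [G HG] := size_le_discrete e0; exists G => n s _ [us s01 H].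
rewrite expn0 muln1; apply: HG => // x y xs ys xy; have [i _] := H x y xs ys xy.
have b01 j z : 0 <= z <= 1 -> 0 <= iter j f z <= 1 by move=> z01; elim: j => //= j; apply: f01.
have -> // : forall j, `|iter j f x - iter j f y| = `|x - y|.
by elim=> // j IH; rewrite !iterS iso ?b01 ?s01.
Qed.

(** A cycle that meets the invariant set V stays in it. Outside V every step at least doubles the
    distance to z, which is possible on a cycle only at z. *)
Lemma transient_periodic f (V : pred R) z p x : (forall y, 0 <= y <= 1 -> 0 <= f y <= 1) ->
  (forall y, 0 <= y <= 1 -> V y -> V (f y)) -> f z = z ->
  (forall y, 0 <= y <= 1 -> ~~ V y -> 2 * `|y - z| <= `|f y - z|) ->
  (0 < p)%N -> iter p f x = x -> 0 <= x <= 1 -> ~~ V x -> x = z.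
Proof.
move=> f01 fV fz expand p0 fx x01 nVx.
have b01 i : 0 <= iter i f x <= 1 by elim: i => // i IH; rewrite iterS f01.
have inv i j : V (iter i f x) -> V (iter (i + j) f x).
  by move=> h; elim: j => [|j IH]; rewrite ?addn0 // addnS iterS; apply: fV.
have nV i : (i <= p)%N -> ~~ V (iter i f x).
  move=> ip; apply: contra nVx => Vi; have := inv i (p - i)%N Vi.
  by rewrite subnKC // fx.
have grow i : (i < p)%N -> 2 * `|x - z| <= `|iter i.+1 f x - z|.
  elim: i => [|i IH] ip; first exact: expand.
  apply: (le_trans (IH (ltnW ip))); apply: le_trans (expand _ (b01 _) (nV _ (ltnW ip))).
  by have := normr_ge0 (iter i.+1 f x - z); lra.
have := grow p.-1; rewrite prednK // fx leqnn => /(_ isT) h.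
apply/eqP; rewrite -subr_eq0 -normr_eq0 eq_le normr_ge0 andbT; lra.
Qed.

End SeparatedBounds.

(** * Constructions by gluing affine pieces to a scaled copy *)

Section GluedMaps.
Context {R : realType}.
Implicit Types (f g F : R -> R) (s : seq R) (a b c d x y z : R).

Definition clamp x : R := Num.max 0 (Num.min 1 x).

Lemma clamp01 x : 0 <= clamp x <= 1.
Proof. by rewrite /clamp le_max lexx ge_max ler01 ge_min lexx. Qed.

Lemma clamp_id x : 0 <= x <= 1 -> clamp x = x.
Proof. by move=> /andP[x0 x1]; rewrite /clamp (min_idPr x1) (max_idPr x0). Qed.

Lemma continuous_clamp : continuous clamp.
Proof.
move=> x; apply: (@continuous_max _ R (fun=> 0) (fun x => Num.min 1 x)); first exact: cvg_cst.
by apply: (@continuous_min _ R (fun=> 1) id); [exact: cvg_cst|exact: cvg_id].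
Qed.

(* Affine of slope c, then d, on the first two thirds of [0, 1], and a copy of f
   scaled by 1/3 on the last third. *)
Definition glue3 a c d f x : R := let y := clamp x in
  a + c * Num.min y (1 / 3) + d * (Num.max (1 / 3) (Num.min (2 / 3) y) - 1 / 3)
  + (f (Num.max 0 (3 * y - 2)) - f 0) / 3.

Lemma glue3_cont a c d f : continuous f -> continuous (glue3 a c d f).
Proof.
move=> cf x.
have cc := continuous_clamp.
have c1 : {for x, continuous (fun x => Num.min (clamp x) (1 / 3))}.
  by apply: (@continuous_min _ R clamp (fun=> 1 / 3)); [exact: cc|exact: cvg_cst].
have c2 : {for x, continuous (fun x => Num.max (1 / 3) (Num.min (2 / 3) (clamp x)))}.
  apply: (@continuous_max _ R (fun=> 1 / 3) (fun x => Num.min (2 / 3) (clamp x))); first exact: cvg_cst.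
  by apply: (@continuous_min _ R (fun=> 2 / 3) clamp); [exact: cvg_cst|exact: cc].
have c3 : {for x, continuous (fun x => f (Num.max 0 (3 * clamp x - 2)))}.
  apply: (@continuous_comp _ _ _ (fun x => Num.max 0 (3 * clamp x - 2)) f); last exact: cf.
  apply: (@continuous_max _ R (fun=> 0) (fun x => 3 * clamp x - 2)); first exact: cvg_cst.
  apply: continuousB; last exact: cvg_cst.
  by apply: cvgM; [exact: cvg_cst|exact: cc].
apply: cvgD; last first.
  apply: cvgM; last exact: cvg_cst.
  by apply: cvgB; [exact: c3|exact: cvg_cst].
apply: cvgD; last first.
  apply: cvgM; first exact: cvg_cst.
  by apply: cvgB; [exact: c2|exact: cvg_cst].
apply: cvgD; first exact: cvg_cst.
by apply: cvgM; [exact: cvg_cst|exact: c1].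
Qed.

Lemma glue3_left a c d f x : 0 <= x <= 1 / 3 -> glue3 a c d f x = a + c * x.
Proof.
move=> xb; rewrite /glue3 clamp_id; last lra.
rewrite (min_idPl _); last lra.
rewrite (max_idPl _); last by rewrite ge_min; apply/orP; right; lra.
rewrite (max_idPl _); last lra.
lra.
Qed.

Lemma glue3_mid a c d f x : 1 / 3 <= x <= 2 / 3 ->
  glue3 a c d f x = a + c / 3 + d * (x - 1 / 3).
Proof.
move=> xb; rewrite /glue3 clamp_id; last lra.
rewrite (min_idPr _); last lra.
rewrite (min_idPr _); last lra.
rewrite (max_idPr _); last lra.
rewrite (max_idPl _); last lra.
lra.
Qed.

Lemma glue3_right a c d f x : 2 / 3 <= x <= 1 ->
  glue3 a c d f x = a + c / 3 + d / 3 + (f (3 * x - 2) - f 0) / 3.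
Proof.
move=> xb; rewrite /glue3 clamp_id; last lra.
rewrite (min_idPr _); last lra.
rewrite (min_idPl _); last lra.
rewrite (max_idPr _); last lra.
rewrite (max_idPr _); last lra.
lra.
Qed.

Lemma glue3_clamp a c d f x : glue3 a c d f x = glue3 a c d f (clamp x).
Proof. by rewrite /glue3 (clamp_id (clamp01 x)). Qed.

Definition conj_third F f (p : R) := forall x, 0 <= x <= 1 -> F (p + x / 3) = p + f x / 3.

Lemma conj_third_iter F f p n : (forall x, 0 <= f x <= 1) ->
  conj_third F f p -> conj_third (iter n F) (iter n f) p.
Proof.
move=> fr H x x01; elim: n => // n IH; rewrite !iterS IH H //.
by case: n {IH} => // n; apply: fr.
Qed.

Lemma conj_third_chain F f p k a b : 0 <= p <= 2 / 3 -> conj_third F f p ->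
  chain f k a b -> chain F k (p + a / 3) (p + b / 3).
Proof.
move=> p01 H.
have cov a' b' c d : 0 <= a' -> b' <= 1 -> covers f a' b' c d ->
    covers F (p + a' / 3) (p + b' / 3) (p + c / 3) (p + d / 3).
  move=> a0 b1 cv y yb; have [|t tb ft] := cv (3 * (y - p)); first lra.
  by exists (p + t / 3); [lra|rewrite H ?ft; lra].
elim: k a b => [|k IH] a b /=; first by move=> [? [? [? _]]]; do !split; lra.
move=> [a0 [ab [b1 [cab [c [d [ccd dis Hc]]]]]]].
do !split; try lra; first exact: cov.
exists (p + c / 3), (p + d / 3); split; [exact: cov| |exact: IH].
by case: dis; [left|right]; lra.
Qed.

Lemma conj_third_least_period F f p q x : (forall x, 0 <= f x <= 1) -> conj_third F f p ->
  0 <= x <= 1 -> least_period F q (p + x / 3) <-> least_period f q x.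
Proof.
move=> fr H x01; have E n : iter n F (p + x / 3) = p + iter n f x / 3.
  exact: (conj_third_iter n fr H).
split=> -[q0 fx K]; (split => //; last move=> k kq).
- by move: fx; rewrite E; lra.
- by move=> h; apply: (K k kq); rewrite E h.
- by rewrite E fx.
- by rewrite E => h; apply: (K k kq); lra.
Qed.

Lemma least_period_image f q x : least_period f q x -> least_period f q (f x).
Proof.
move=> [q0 fx H]; split => //; first by rewrite -iterSr iterS fx.
move=> k kq E; apply: (H k kq).
have back y : iter q.-1 f (f y) = iter q f y by rewrite -iterSr prednK.
have : iter q.-1 f (f (iter k f x)) = iter q.-1 f (f x) by congr (iter _ _ _); rewrite -iterS iterSr E.
by rewrite !back fx -iterD addnC iterD fx.
Qed.

Definition pow2_type f n := periods f (2 ^ n)%N /\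
  forall q, periods f q -> exists2 m, (m <= n)%N & q = (2 ^ m)%N.

Lemma pow2_type_periods f n : pow2_type f n -> pow2_periods f.
Proof. by move=> [_ H] q /H[m _ ->]; exists m. Qed.

(* The repelling fixed point 0 is put in front of a copy of f, all of which is
   reached from it. *)
Definition add_source f := glue3 0 3 (f 0 - 1) f.
(* The outer thirds are exchanged, the square on the first one being a copy of f;
   the middle third contains a repelling fixed point. *)
Definition doubling f := glue3 (2 / 3) 1 (f 0 - 3) f.

Section AddSource.
Context (f : R -> R) (sf : self_map f).
Let F := add_source f.

Lemma add_source_conj : conj_third F f (2 / 3).
Proof.
(* The slope [f 0 - 1] leads from 1 at [1 / 3] to [2 / 3 + f 0 / 3] at [2 / 3], where the copy of f
   starts. *)
move=> x x01; rewrite /F /add_source glue3_right; last lra.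
have -> : 3 * (2 / 3 + x / 3) - 2 = x by lra.
lra.
Qed.

Lemma add_source_left x : 0 <= x <= 1 / 3 -> F x = 3 * x.
Proof. by move=> xb; rewrite /F /add_source glue3_left //; lra. Qed.

Lemma add_source_mid x : 1 / 3 <= x <= 1 -> 2 / 3 <= F x <= 1.
Proof.
move=> xb; have [_ fr] := sf; have := fr 0.
have [h|h] := leP x (2 / 3).
  rewrite /F /add_source glue3_mid; last lra.
  by nra.
have := fr (3 * x - 2); rewrite /F /add_source glue3_right; lra.
Qed.

Lemma add_source_self_map : self_map F.
Proof.
have [cf fr] := sf; split; first exact: glue3_cont.
move=> x; rewrite /F /add_source glue3_clamp -/(add_source f) -/F.
have := clamp01 x; set y := clamp x => y01.
have [h|h] := leP y (1 / 3); first by rewrite add_source_left; lra.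
by have := @add_source_mid y; lra.
Qed.

(** The transient part is the first third, where F has slope 3; one step carries the rest into the
    copy of f on the last third. *)
Lemma add_source_bound k : poly_bound f k -> poly_bound F k.+1.
Proof.
move=> Hf; have [cF Fr] := add_source_self_map.
apply: (@transient_bound _ F (fun x => x < 1 / 3)) => [x _|x y x01 y01 Ux Uy|]; first exact: Fr.
  rewrite !add_source_left; try lra.
  by rewrite -mulrBr normrM ger0_norm //; have := normr_ge0 (x - y); lra.
apply: (@sep_bound_preim _ F _ (fun x => 2 / 3 <= x)).
  move=> x x01 /=; rewrite -leNgt => h; split; first exact: Fr.
  by have := @add_source_mid x; lra.
move=> e e0; have [|C HC] := Hf (3 * e); first lra.
exists C => n s n0 [us s01 H] /allP sR.
rewrite -(size_map (fun x => 3 * x - 2)); apply: HC => //.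
have xE x : x = 2 / 3 + (3 * x - 2) / 3 by lra.
have sR' x : x \in s -> 0 <= 3 * x - 2 <= 1 by move=> xs; have := sR x xs; have := s01 x xs; lra.
split.
- by rewrite map_inj_uniq // => x y; lra.
- by move=> _ /mapP[x xs ->]; apply: sR'.
- move=> _ _ /mapP[x xs ->] /mapP[y ys ->] xy.
  have [|i ni h] := H x y xs ys; first by apply: contraNneq xy => ->.
  exists i => //; move: h; rewrite {1}(xE x) {1}(xE y).
  rewrite !(conj_third_iter i (proj2 sf) add_source_conj) ?sR' //.
  have -> : forall u v : R, 2 / 3 + u / 3 - (2 / 3 + v / 3) = (u - v) / 3 by move=> *; lra.
  by rewrite normrM (@ger0_norm _ 3^-1) ?invr_ge0 //; lra.
Qed.

Lemma add_source_chain k : has_chain f k -> has_chain F k.+1.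
Proof.
move=> [N N0 [a [b Hc]]]; have [cF Fr] := add_source_self_map.
(* Doubling N provides the two steps in which [0, 1/9] is stretched over [0, 1]. *)
have Hc2 := chain_iterM (isT : (0 < 2)%N) Hc.
have b23 : 0 <= (2 / 3 : R) <= 2 / 3 by lra.
have HF := conj_third_chain b23 (conj_third_iter (2 * N) (proj2 sf) add_source_conj) Hc2.
have [a0 ab b1] := chain_bounds HF; have [a0' _ _] := chain_bounds Hc.
exists (2 * N)%N; first by rewrite muln_gt0.
have c1 : covers F 0 (1 / 9) 0 (1 / 3).
  move=> y yb; exists (y / 3); first lra.
  by rewrite add_source_left; lra.
have c2 : covers F 0 (1 / 3) 0 1.
  move=> y yb; exists (y / 3); first lra.
  by rewrite add_source_left; lra.
have c3 : covers F 0 1 0 1 by apply: covers_sub c2; lra.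
have c : covers (iter (2 * N) F) 0 (1 / 9) 0 1.
  have -> : (2 * N = (2 * N - 2) + (1 + 1))%N by rewrite addn1 subnK // -{1}[2%N]muln1 leq_mul2l.
  have c12 := @covers_iterD _ F 1 1 _ _ _ _ _ _ c1 c2.
  exact: covers_iterD c12 (covers_self_iter _ c3).
exists 0, (1 / 9); do !split; try lra; first by apply: covers_sub c; lra.
exists (2 / 3 + a / 3), (2 / 3 + b / 3); split => //; last by left; lra.
by apply: covers_sub c; lra.
Qed.

Lemma add_source_periods q : periods F q -> q = 1%N \/ periods f q.
Proof.
move=> /periodsP[x x01 lq]; have [q0 fx H] := lq; have [cF Fr] := add_source_self_map.
have E0 : F 0 = 0 by rewrite add_source_left; lra.
have [h|h] := leP (1 / 3) x; last first.
  left; have x0 : x = 0.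
    apply: (@transient_periodic _ F (fun y => 1 / 3 <= y) 0 q x) => //.
    - move=> y y01 /= yb; have : 2 / 3 <= F y <= 1 by apply: add_source_mid; lra.
      lra.
    - move=> y y01 /=; rewrite -ltNge => yb; rewrite add_source_left; last lra.
      by rewrite !subr0 normrM (@ger0_norm _ 3) //; have := normr_ge0 y; lra.
    - by rewrite -ltNge.
  by have := @least_period_dvdn _ F q x 1 lq; rewrite x0 dvdn1 => /(_ E0)/eqP.
right; have inR n : 2 / 3 <= iter n.+1 F x <= 1.
  elim: n => [|n IH]; first by apply: add_source_mid; rewrite /= h; lra.
  by rewrite iterS; apply: add_source_mid; lra.
have xR : 2 / 3 <= x <= 1 by rewrite -fx -(prednK q0).
apply/periodsP; exists (3 * x - 2); first lra.
apply/(conj_third_least_period _ (proj2 sf) add_source_conj); first lra.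
by have -> : 2 / 3 + (3 * x - 2) / 3 = x by lra.
Qed.

Lemma add_source_type n : pow2_type f n -> pow2_type F n.
Proof.
move=> [fn H]; split.
  have /periodsP[x x01 lx] := fn; apply/periodsP; exists (2 / 3 + x / 3); first lra.
  exact/(conj_third_least_period _ (proj2 sf) add_source_conj).
by move=> q /add_source_periods[->|/H//]; exists 0%N.
Qed.

End AddSource.

Section Double.
Context (f : R -> R) (sf : self_map f).
Let F := doubling f.

Lemma doubling_left x : 0 <= x <= 1 / 3 -> F x = 2 / 3 + x.
Proof. by move=> xb; rewrite /F /doubling glue3_left //; lra. Qed.

(** The slope [f 0 - 3] leads from 1 at [1 / 3] to [f 0 / 3] at [2 / 3], so the constants cancel. *)
Lemma doubling_right x : 2 / 3 <= x <= 1 -> F x = f (3 * x - 2) / 3.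
Proof. by move=> xb; rewrite /F /doubling glue3_right //; lra. Qed.

Lemma doubling_mid x : 1 / 3 <= x <= 2 / 3 -> F x = 1 + (f 0 - 3) * (x - 1 / 3).
Proof. by move=> xb; rewrite /F /doubling glue3_mid //; lra. Qed.

Lemma doubling_right_bound x : 2 / 3 <= x <= 1 -> 0 <= F x <= 1 / 3.
Proof. by move=> xb; rewrite doubling_right //; have := proj2 sf (3 * x - 2); lra. Qed.

Lemma doubling_self_map : self_map F.
Proof.
have [cf fr] := sf; split; first exact: glue3_cont.
move=> x; rewrite /F /doubling glue3_clamp -/(doubling f) -/F.
have := clamp01 x; set y := clamp x => y01.
have [h|h] := leP y (1 / 3); first by rewrite doubling_left; lra.
have [h'|h'] := leP y (2 / 3); last by have := @doubling_right_bound y; lra.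
by rewrite doubling_mid; [have := fr 0; nra|lra].
Qed.

Lemma doubling_conj : conj_third (iter 2 F) f 0.
Proof.
move=> x x01; rewrite /= (@doubling_left (0 + x / 3)); last lra.
rewrite doubling_right; last lra.
have -> : 3 * (2 / 3 + (0 + x / 3)) - 2 = x by lra.
lra.
Qed.

Lemma doubling_iter_even n x : 0 <= x <= 1 -> iter n.*2 F (x / 3) = iter n f x / 3.
Proof.
move=> x01; have := conj_third_iter n (proj2 sf) doubling_conj x01.
by rewrite iter_iter muln2 !add0r.
Qed.

Lemma doubling_iter_odd n x : 0 <= x <= 1 -> iter n.*2.+1 F (x / 3) = 2 / 3 + iter n f x / 3.
Proof.
move=> x01; rewrite iterS doubling_iter_even // doubling_left //.
have : 0 <= iter n f x <= 1 by case: n => // n; apply: (proj2 sf).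
lra.
Qed.

Lemma doubling_chain k : has_chain f k -> has_chain F k.
Proof.
move=> [N N0 [a [b Hc]]]; apply: (@has_chain_iter _ _ 2) => //; exists N => //.
have b0 : 0 <= (0 : R) <= 2 / 3 by lra.
by have := conj_third_chain b0 (conj_third_iter N (proj2 sf) doubling_conj) Hc; eexists; eexists; eassumption.
Qed.

(** The transient part is the open middle third, where the slope is at least 2 in absolute value. On
    the left third the even iterates copy those of f and the odd ones differ from them by a
    translation; the right third enters the left one in one step. *)
Lemma doubling_bound k : poly_bound f k -> poly_bound F k.+1.
Proof.
move=> Hf; have [cF Fr] := doubling_self_map.
apply: (@transient_bound _ F (fun x => 1 / 3 < x < 2 / 3)) => [x _|x y x01 y01 Ux Uy|]; first exact: Fr.
  rewrite !doubling_mid; try lra.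
  have -> : 1 + (f 0 - 3) * (x - 1 / 3) - (1 + (f 0 - 3) * (y - 1 / 3)) = (f 0 - 3) * (x - y) by ring.
  rewrite normrM ltr0_norm; last by have := proj2 sf 0; lra.
  by have := normr_ge0 (x - y); have := proj2 sf 0; nra.
have HL : sep_bound F (fun x => x <= 1 / 3) k.
  move=> e e0; have [|C HC] := Hf (3 * e); first lra.
  exists C => n s n0 [us s01 H] /allP sR.
  rewrite -(size_map (fun x => 3 * x)); apply: HC => //.
  have xE x : x = (3 * x) / 3 by lra.
  have sR' x : x \in s -> 0 <= 3 * x <= 1 by move=> xs; have := sR x xs; have := s01 x xs; lra.
  split.
  - by rewrite map_inj_uniq // => x y; lra.
  - by move=> _ /mapP[x xs ->]; apply: sR'.
  - move=> _ _ /mapP[x xs ->] /mapP[y ys ->] xy.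
    have [|i ni h] := H x y xs ys; first by apply: contraNneq xy => ->.
    exists i./2; first by apply: leq_ltn_trans ni; rewrite leq_half_double -addnn -addnS leq_addr.
    have hE (u v : R) : `|u / 3 - v / 3| = `|u - v| / 3.
      by rewrite -mulrBl normrM (@ger0_norm _ 3^-1) ?invr_ge0.
    move: h; rewrite {1}(xE x) {1}(xE y) -{1 2}(odd_double_half i).
    case: (odd i); rewrite ?add1n ?add0n.
      rewrite !doubling_iter_odd ?sR' //.
      by rewrite opprD addrACA subrr add0r hE; lra.
    by rewrite !doubling_iter_even ?sR' // hE; lra.
apply: (@sep_boundW _ F _ (predU (fun x => x <= 1 / 3) (fun x => 2 / 3 <= x))).
  by move=> x x01 /=; rewrite negb_and -!leNgt.
apply: sep_boundU => //; apply: sep_bound_preim HL => x x01 h.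
by have := @doubling_right_bound x; lra.
Qed.

Lemma doubling_least_period p x : 0 <= x <= 1 ->
  least_period F p.*2 (x / 3) <-> least_period f p x.
Proof.
move=> x01; split=> -[p0 fx H]; (split; [by move: p0; rewrite double_gt0| |move=> k kp]).
- by move: fx; rewrite doubling_iter_even //; lra.
- move=> h; apply: (H k.*2); first by rewrite double_gt0 ltn_double.
  by rewrite doubling_iter_even // h.
- by rewrite doubling_iter_even // fx.
- rewrite -(odd_double_half k); case: (boolP (odd k)) => ok; rewrite ?add1n ?add0n.
    have : 0 <= iter k./2 f x <= 1 by case: (k./2) => // n; apply: (proj2 sf).
    by rewrite doubling_iter_odd //; lra.
  rewrite doubling_iter_even // => h; apply: (H k./2); last lra.
  by move: kp; rewrite -{1 2}(odd_double_half k) (negbTE ok) add0n double_gt0 ltn_double.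
Qed.

Lemma doubling_periods q : periods F q -> q = 1%N \/ exists2 p, periods f p & q = p.*2.
Proof.
move=> /periodsP[x x01 lq]; have [q0 fx H] := lq; have [cF Fr] := doubling_self_map.
have left y : 0 <= y <= 1 / 3 -> least_period F q y -> exists2 p, periods f p & q = p.*2.
  move=> yb ly; have [_ fy _] := ly; have yE : y = (3 * y) / 3 by lra.
  have y01 : 0 <= 3 * y <= 1 by lra.
  have qE : q = q./2.*2.
    rewrite -[LHS]odd_double_half; case: (boolP (odd q)) => // oq; exfalso.
    have hb : 0 <= iter q./2 f (3 * y) <= 1 by case: (q./2) => // n; apply: (proj2 sf).
    by move: fy; rewrite yE -(odd_double_half q) oq add1n doubling_iter_odd // -yE; lra.
  exists q./2 => //; apply/periodsP; exists (3 * y) => //.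
  by apply/doubling_least_period => //; rewrite -qE -yE.
have [h|h] := leP x (1 / 3); first by right; apply: (left x) => //; lra.
have [h'|h'] := leP (2 / 3) x.
  right; apply: (left (F x)); first by apply: doubling_right_bound; lra.
  exact: least_period_image.
left.
have [||z zb fz] := @fixpoint_between _ F (1 / 3) (2 / 3) cF; first lra.
  by right; have := proj2 sf 0; rewrite !doubling_mid; lra.
have xz : x = z.
  apply: (@transient_periodic _ F (fun y => (y <= 1 / 3) || (2 / 3 <= y)) z q x) => //.
  - move=> y y01 /orP[yb|yb]; apply/orP; [right|left].
      by rewrite doubling_left; lra.
    by have := @doubling_right_bound y; lra.
  - move=> y y01; rewrite negb_or -!ltNge => yb.
    rewrite -{2}fz !doubling_mid; try lra.
    have -> : 1 + (f 0 - 3) * (y - 1 / 3) - (1 + (f 0 - 3) * (z - 1 / 3)) = (f 0 - 3) * (y - z) by ring.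
    rewrite normrM (@ltr0_norm _ (f 0 - 3)); last by have := proj2 sf 0; lra.
    by have := normr_ge0 (y - z); have := proj2 sf 0; nra.
  - by rewrite negb_or -!ltNge h.
by have := @least_period_dvdn _ F q x 1 lq; rewrite xz dvdn1 => /(_ fz)/eqP.
Qed.

Lemma doubling_type n : pow2_type f n -> pow2_type F n.+1.
Proof.
move=> [fn H]; split.
  have /periodsP[x x01 lx] := fn; apply/periodsP; exists (x / 3); first lra.
  by rewrite expnS mul2n; apply/doubling_least_period.
move=> q /doubling_periods[->|[p /H[m mn ->] ->]]; first by exists 0%N.
by exists m.+1; rewrite ?ltnS // expnS mul2n.
Qed.

End Double.

End GluedMaps.

(** * Values of the polynomial entropy *)

Section Values.
Context {R : realType}.
Implicit Types (f g F : R -> R) (x y z : R).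

Lemma interval_map_range f x : interval_map f -> 0 <= x <= 1 -> 0 <= f x <= 1.
Proof. by move=> [_ H] x01; have := H x; rewrite /= !in_itv /=; apply. Qed.

(** Composition with [clamp] makes f continuous on the whole line with values in [0, 1], and leaves
    the orbits in [0, 1] unchanged. *)
Lemma clamp_self_map f : interval_map f -> self_map (f \o clamp).
Proof.
move=> imf; split; last by move=> x /=; apply: interval_map_range => //; apply: clamp01.
move=> x; apply/cvgrPdist_lt => e e0.
have [/(subspace_continuousP _ f) cf _] := imf.
have cx : `[0, 1]%classic (clamp x) by rewrite /= in_itv /= clamp01.
have /cvgrPdist_lt /(_ e e0) := cf _ cx.
rewrite near_withinE => /nbhs_ballP[r /= r0 H].
have [d d0 Hd] := continuous_eps x (@continuous_clamp R) r0.
apply/nbhs_ballP; exists d => //= y yx; apply: H => /=.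
  by rewrite /ball /= distrC; apply: Hd; rewrite distrC.
by rewrite in_itv /= clamp01.
Qed.

Lemma clamp_iter f n x : interval_map f -> 0 <= x <= 1 -> iter n (f \o clamp) x = iter n f x.
Proof.
move=> imf x01; elim: n => // n IH; rewrite !iterS IH /= clamp_id //.
by elim: n {IH} => // n IH; rewrite iterS; apply: interval_map_range.
Qed.

Lemma clamp_h_pol f : interval_map f -> h_pol f = h_pol (f \o clamp).
Proof. by move=> imf; apply: eq_h_pol => n x x01; rewrite clamp_iter. Qed.

Lemma clamp_periods f : interval_map f -> periods (f \o clamp) = periods f.
Proof.
move=> imf; apply/funext => p; apply/propext; split=> /periodsP[x x01 [p0 fx H]];
  apply/periodsP; exists x => //; split => //.
- by rewrite -clamp_iter.
- by move=> k kp; rewrite -clamp_iter //; apply: H.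
- by rewrite clamp_iter.
- by move=> k kp; rewrite clamp_iter //; apply: H.
Qed.

Lemma self_map_interval_map f : self_map f -> interval_map f.
Proof.
move=> [cf fr]; split; first exact: continuous_subspaceT.
by move=> x _; rewrite /= in_itv /=; apply: fr.
Qed.

Lemma pow2_odd_neq a b q : odd q -> (1 < q)%N -> (2 ^ a <> 2 ^ b * q)%N.
Proof.
move=> oq q1 E; have : (q %| 2 ^ a)%N by rewrite E dvdn_mull.
case/(dvdn_pfactor _ _ (isT : prime 2)) => m _ qE.
by move: oq q1; rewrite qE oddX; case: m {qE}.
Qed.

Lemma sharkovskii_pow2 f n : has_sharkovskii_type f (Period (2 ^ n)) <-> pow2_type f n.
Proof.
have pow_inj a b : (2 ^ a = 2 ^ b)%N -> a = b.
  by move/eqP; rewrite eqn_exp2l // => /eqP.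
split=> -[fn H]; split => // q /H.
  case=> [[->]|lt]; first by exists n.
  inversion lt as [a b ab|a|a b r odr r1|b r odr r1|a b r r' ? ? odr r1 ab|a r r' ? odr r1 rr]; subst.
  - by exists a => //; rewrite ltnW // -(pow_inj b n).
  - by exfalso; apply: (@pow2_odd_neq n b r).
  - by exfalso; apply: (@pow2_odd_neq n a r').
  - by exfalso; apply: (@pow2_odd_neq n a r').
case=> m; rewrite leq_eqVlt => /predU1P[->|mn] ->; first by left.
by right; constructor.
Qed.

Lemma sharkovskii_ge_TwoInfty t : sharkovskii_le TwoInfty t -> t = TwoInfty \/
  exists b q, [/\ odd q, (1 < q)%N & t = Period (2 ^ b * q)].
Proof.
case=> [<-|lt]; first by left.
by right; inversion lt; exists b, q.
Qed.

Lemma odd_period_h_pol f b q : self_map f -> odd q -> (1 < q)%N ->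
  periods f (2 ^ b * q)%N -> h_pol f = +oo%E.
Proof.
move=> sf oq q1 /periodsP[x x01 [p0 fx H]]; have b0 : (0 < 2 ^ b)%N by rewrite expn_gt0.
apply: has_chain_oo => k; apply: (has_chain_iter b0).
apply: (@odd_horseshoe _ _ q x) => //.
  have [cf fr] := sf; split; first exact: continuous_iter.
  by case: (2 ^ b)%N b0 => // m _ y; apply: fr.
split; first exact: ltnW.
  by rewrite iter_iter mulnC.
move=> m /andP[m0 mq]; rewrite iter_iter mulnC; apply: H.
by rewrite muln_gt0 b0 m0 ltn_mul2l b0.
Qed.

Lemma pow2_type_has_chain f n : self_map f -> pow2_type f n.+1 -> has_chain f n.
Proof.
move=> sf tf; have [/periodsP[x x01 lx] _] := tf.
have [N [a [b [N0 Hc _ _]]]] := pow2_chain sf (pow2_type_periods tf) lx.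
by exists N => //; exists a, b.
Qed.

Lemma self_map_clamp : self_map (@clamp R).
Proof. by split; [exact: continuous_clamp|exact: clamp01]. Qed.

Lemma clamp_type : pow2_type (@clamp R) 0.
Proof.
split.
  apply/periodsP; exists 0; first lra.
  by split=> // [|[|[]]//]; rewrite /= clamp_id; lra.
move=> q /periodsP[x x01 lx]; exists 0%N => //.
by have := @least_period_dvdn _ _ _ _ 1 lx; rewrite dvdn1 => /(_ (clamp_id x01))/eqP.
Qed.

Lemma clamp_bound : poly_bound (@clamp R) 0.
Proof.
apply: isometry_bound => [x y x01 y01|x _]; last exact: clamp01.
by rewrite !clamp_id.
Qed.

Definition flip x : R := 1 - clamp x.

Lemma flipE x : 0 <= x <= 1 -> flip x = 1 - x.
Proof. by move=> x01; rewrite /flip clamp_id. Qed.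

Lemma self_map_flip : self_map flip.
Proof.
split=> x; last by have := clamp01 x; rewrite /flip; lra.
by apply: cvgB; [exact: cvg_cst|exact: continuous_clamp].
Qed.

Lemma flip_type : pow2_type flip 1.
Proof.
have f2 x : 0 <= x <= 1 -> iter 2 flip x = x.
  by move=> x01; rewrite /= flipE ?flipE ?subKr //; lra.
split.
  apply/periodsP; exists 0; first lra.
  split=> //; first by rewrite f2 //; lra.
  case=> [|[|[]]] // _; rewrite /= flipE; lra.
move=> q /periodsP[x x01 lx].
have := least_period_dvdn lx (f2 x x01).
by rewrite dvdn_divisors // => /[!inE] /orP[/eqP->|/eqP->]; [exists 0%N|exists 1%N].
Qed.

Lemma flip_bound : poly_bound flip 0.
Proof.
apply: isometry_bound => [x y x01 y01|x _]; last by case: self_map_flip.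
rewrite !flipE //; have -> : 1 - x - (1 - y) = y - x by ring.
by rewrite distrC.
Qed.

(** The entropy is recorded by an upper and a lower bound, in the form in which [add_source] acts on
    each. *)
Definition exact_example f n k :=
  [/\ self_map f, pow2_type f n, poly_bound f k & has_chain f k].

Lemma exact_example_h_pol f n k : exact_example f n k ->
  [/\ interval_map f, has_sharkovskii_type f (Period (2 ^ n)) & h_pol f = k%:R%:E].
Proof.
move=> [sf tf bf cf]; split; first exact: self_map_interval_map.
  exact/sharkovskii_pow2.
by apply/eqP; rewrite eq_le h_pol_le // has_chain_h_pol.
Qed.

Lemma exact_example_add f n k j : exact_example f n k ->
  exists g, exact_example g n (k + j).
Proof.
elim: j k f => [|j IH] k f ex; first by exists f; rewrite addn0.
rewrite -addSnnS; apply: (IH k.+1 (add_source f)); have [sf tf bf cf] := ex.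
split; [exact: add_source_self_map|exact: add_source_type|exact: add_source_bound|exact: add_source_chain].
Qed.

(** Doubling is only used to control the upper bound. The matching chain of length n exists in every
    map of type [2 ^ n.+1]. *)
Lemma exact_example_double n : exists f, exact_example f n.+1 n.
Proof.
have [f [sf tf bf]] : exists f, [/\ self_map f, pow2_type f n.+1 & poly_bound f n].
  elim: n => [|n [f [sf tf bf]]].
    by exists flip; split; [exact: self_map_flip|exact: flip_type|exact: flip_bound].
  exists (doubling f).
  by split; [exact: doubling_self_map|exact: doubling_type|exact: doubling_bound].
by exists f; split => //; exact: pow2_type_has_chain.
Qed.

Lemma exact_example0 : exact_example (@clamp R) 0 0.
Proof.
split; [exact: self_map_clamp|exact: clamp_type|exact: clamp_bound|].
by exists 1%N => //; exists 0, 1; do !split; lra.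
Qed.

(* As pi / 0 = 0 in the library, wave 0 = 0. *)
Definition wave (u : R) : R := u * `|sin (pi / u)|.

Lemma wave_bound u : 0 <= u -> 0 <= wave u <= u.
Proof.
move=> u0; rewrite /wave mulr_ge0 //= -[leRHS]mulr1 ler_wpM2l // ler_norml.
by rewrite sin_geN1 sin_le1.
Qed.

Lemma continuous_wave : continuous wave.
Proof.
move=> u; have [->|u0] := eqVneq u 0; last first.
  have c1 : {for u, continuous (fun u : R => pi / u)}.
    by apply: cvgM; [exact: cvg_cst|apply: cvgV => //; exact: cvg_id].
  have c2 : {for u, continuous (fun u : R => sin (pi / u))}.
    exact: (continuous_comp c1 (@continuous_sin R _)).
  have c3 : {for u, continuous (fun u : R => `|sin (pi / u)|)}.
    by apply: (continuous_comp c2); exact: norm_continuous.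
  by apply: cvgM; [exact: cvg_id|exact: c3].
have w0 : wave 0 = 0 by rewrite /wave mul0r.
apply/cvgrPdist_lt => e e0; apply/nbhs_ballP; exists e => //= y.
rewrite /ball /= w0 !sub0r !normrN => ye.
apply: le_lt_trans ye; rewrite /wave normrM normr_id -[leRHS]mulr1 ler_wpM2l //.
by rewrite ler_norml sin_geN1 sin_le1.
Qed.

Lemma abs_sin_shift (x : R) n : `|sin (x + n%:R * pi)| = `|sin x|.
Proof.
elim: n => [|n IH]; first by rewrite mul0r addr0.
by rewrite -natr1 mulrDl mul1r addrA sinDpi normrN.
Qed.

Lemma wave_zero n : wave n.+1%:R^-1 = 0.
Proof.
rewrite /wave invrK -[pi * _]add0r [pi * _]mulrC abs_sin_shift sin0 normr0.
by rewrite mulr0.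
Qed.

Lemma wave_peak n : wave (n%:R + 2^-1)^-1 = (n%:R + 2^-1)^-1.
Proof.
rewrite /wave invrK; have -> : pi * (n%:R + 2^-1) = pi / 2 + n%:R * pi :> R by ring.
by rewrite abs_sin_shift sin_pihalf normr1 mulr1.
Qed.

(* The fixed points 1 - 1/n are repelling from the right, and the graph rises
   high enough between two of them for each one to be linked to the next. *)
Definition staircase x : R := 1 - (1 - clamp x) + wave (1 - clamp x) / 2.

Lemma staircaseE x : 0 <= x <= 1 -> staircase x = x + wave (1 - x) / 2.
Proof. by move=> x01; rewrite /staircase clamp_id // subKr. Qed.

Lemma self_map_staircase : self_map staircase.
Proof.
split=> x; last first.
  have c01 := clamp01 x; have := @wave_bound (1 - clamp x); rewrite /staircase; lra.
have c1 : {for x, continuous (fun x => 1 - clamp x)}.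
  by apply: cvgB; [exact: cvg_cst|exact: continuous_clamp].
apply: cvgD; first by apply: cvgB; [exact: cvg_cst|exact: c1].
apply: cvgM; last exact: cvg_cst.
by apply: (@continuous_comp _ _ _ (fun x => 1 - clamp x) wave) => //; exact: continuous_wave.
Qed.

Lemma staircase_type : pow2_type staircase 0.
Proof.
split.
  apply/periodsP; exists 1; first lra.
  by split=> // [|[|[]]//]; rewrite /= staircaseE ?subrr /wave ?mul0r ?addr0 //; lra.
move=> q /periodsP[x x01 lx]; exists 0%N => //.
have [cf fr] := self_map_staircase.
have up y : 0 <= y <= 1 -> y <= staircase y.
  by move=> y01; rewrite staircaseE //; have := @wave_bound (1 - y); lra.
have mono n : staircase x <= iter n.+1 staircase x.
  elim: n => // n IH; apply: (le_trans IH); rewrite [leRHS]iterS; apply: up.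
  by rewrite iterS; apply: fr.
have [q0 fx _] := lx.
have E : staircase x = x.
  by apply/eqP; rewrite eq_le up // andbT -[leRHS]fx -(prednK q0) mono.
by have := @least_period_dvdn _ _ _ _ 1 lx; rewrite dvdn1 => /(_ E)/eqP.
Qed.

Lemma staircase_has_chain k : has_chain staircase k.
Proof.
have [cf fr] := self_map_staircase.
have pos (n : nat) : 0 < n.+1%:R :> R by rewrite ltr0n.
have suc (n : nat) : n.+2%:R = n.+1%:R + 1 :> R by rewrite natr1.
have [u uE] : exists u : nat -> R, forall n, u n = n.+1%:R^-1 by eexists.
have [v vE] : exists v : nat -> R, forall n, v n = (n.+1%:R + 2^-1)^-1 by eexists.
have u0 n : 0 < u n by rewrite uE invr_gt0.
have u1 n : u n <= 1 by rewrite uE invf_le1 ?ler1n.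
have uv n : v n < u n.
  by rewrite uE vE ltf_pV2 ?posrE //; have := pos n; lra.
have vu n : u n.+1 < v n.
  by rewrite uE vE ltf_pV2 ?posrE //; have := pos n; have := suc n; lra.
have vv n : v n / 2 <= v n.+1.
  have ge1 : 1 <= n.+1%:R :> R by rewrite ler1n.
  by rewrite !vE -invfM lef_pV2 ?posrE; have := suc n; lra.
(* The zero [u n] of [wave] gives the fixed point [p n], and the peak [v n] gives [m n], which is
   lifted by [v n / 2] to at least [m n.+1]. *)
pose p n : R := 1 - u n; pose m n : R := 1 - v n.
have p01 n : 0 <= p n <= 1 by have := u0 n; have := u1 n; rewrite /p; lra.
have pm n : p n < m n by have := uv n; rewrite /p /m; lra.
have mp n : m n < p n.+1 by have := vu n; rewrite /p /m; lra.
have m01 n : 0 <= m n <= 1 by have := p01 n; have := p01 n.+1; have := pm n; have := mp n; lra.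
have fp n : staircase (p n) = p n.
  by rewrite staircaseE // /p subKr uE wave_zero mul0r addr0.
have fm n : m n.+1 <= staircase (m n).
  have w : wave (v n) = v n by rewrite vE wave_peak.
  by rewrite staircaseE // /m subKr w; have := vv n; lra.
have H j n : chain staircase j (p n) (m n).
  elim: j n => [|j IH] n; first by have := p01 n; have := m01 n; have := pm n; do !split; lra.
  have cov : covers staircase (p n) (m n) (p n) (m n.+1).
    apply: (@covers_ivt _ _ _ _ _ _ (p n) (m n)) => //; rewrite ?fp ?lexx ?ltW //; exact: pm.
  have h1 := pm n; have h2 := mp n; have h3 := pm n.+1; have h4 := p01 n; have h5 := m01 n.
  do !split; try lra; first by apply: covers_sub cov; lra.
  exists (p n.+1), (m n.+1); split; [|by left|exact: IH].
  by apply: covers_sub cov; lra.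
by exists 1%N => //; exists (p 0%N), (m 0%N); apply: H.
Qed.

Lemma infinite_example n : exists f,
  [/\ interval_map f, has_sharkovskii_type f (Period (2 ^ n)) & h_pol f = +oo%E].
Proof.
have [f [sf tf cf]] : exists f, [/\ self_map f, pow2_type f n & forall k, has_chain f k].
  elim: n => [|n [f [sf tf cf]]].
    by exists staircase; split;
      [exact: self_map_staircase|exact: staircase_type|exact: staircase_has_chain].
  exists (doubling f); split; [exact: doubling_self_map|exact: doubling_type|].
  by move=> k; apply: doubling_chain.
exists f; split; [exact: self_map_interval_map|exact/sharkovskii_pow2|exact: has_chain_oo].
Qed.

Lemma pow2_type_rigidity f n : interval_map f -> has_sharkovskii_type f (Period (2 ^ n)) ->
  (exists k, (n - 1 <= k)%N /\ h_pol f = k%:R%:E) \/ h_pol f = +oo%E.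
Proof.
move=> imf /sharkovskii_pow2; have sf := clamp_self_map imf.
rewrite clamp_h_pol //; rewrite /pow2_type -clamp_periods // -/(pow2_type _ n) => tf.
have b0 : (0 < 2 ^ n)%N by rewrite expn_gt0.
have [q /(proj2 tf)[m mn ->]|[k hk kmax]|] := rigidity sf b0.
- exact: dvdn_exp2l.
- left; exists k; split => //; case: n tf {b0} => // n tf.
  by rewrite subSS subn0; apply: kmax; apply: pow2_type_has_chain.
- by right.
Qed.

End Values.

Theorem theorem30 (R : realType) :
  (* (1) type 1 *)
  ((forall f : R -> R, interval_map f -> has_sharkovskii_type f (Period 1) ->
      (exists k : nat, h_pol f = (k%:R)%:E) \/ h_pol f = +oo%E) /\
   (forall k : nat, exists f : R -> R,
      [/\ interval_map f, has_sharkovskii_type f (Period 1)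
        & h_pol f = (k%:R)%:E]) /\
   (exists f : R -> R,
      [/\ interval_map f, has_sharkovskii_type f (Period 1)
        & h_pol f = +oo%E])) /\
  (* (2) type 2^n, n >= 1 *)
  (forall n : nat, (1 <= n)%N ->
    (forall f : R -> R, interval_map f ->
      has_sharkovskii_type f (Period (2 ^ n)) ->
      (exists k : nat, (n - 1 <= k)%N /\ h_pol f = (k%:R)%:E)
        \/ h_pol f = +oo%E) /\
    (forall k : nat, (n - 1 <= k)%N -> exists f : R -> R,
      [/\ interval_map f, has_sharkovskii_type f (Period (2 ^ n))
        & h_pol f = (k%:R)%:E]) /\
    (exists f : R -> R,
      [/\ interval_map f, has_sharkovskii_type f (Period (2 ^ n))
        & h_pol f = +oo%E])) /\
  (* (3) type 2^oo or greater *)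
  (forall (f : R -> R) (t : sharkovskii_index), interval_map f ->
    has_sharkovskii_type f t -> sharkovskii_le TwoInfty t ->
    h_pol f = +oo%E).
Proof.
split; [split; [|split]|split].
- move=> f imf tf; have [[k [_ hk]]|] := @pow2_type_rigidity R f 0 imf tf; last by right.
  by left; exists k.
- move=> k; have [f ex] := exact_example_add k (@exact_example0 R).
  by exists f; have := exact_example_h_pol ex.
- exact: (infinite_example 0).
- case=> // n _; split; [|split]; last exact: infinite_example.
    by move=> f imf; apply: pow2_type_rigidity.
  move=> k nk; rewrite subSS subn0 in nk; have [f ex] := @exact_example_double R n.
  have [g exg] := exact_example_add (k - n) ex; exists g.
  by have := exact_example_h_pol exg; rewrite subnKC.
- move=> f t imf tf /sharkovskii_ge_TwoInfty; have sf := clamp_self_map imf.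
  rewrite clamp_h_pol // => -[tE|[b [q [oq q1 tE]]]]; rewrite tE /= in tf.
  + rewrite -clamp_periods // in tf; apply: has_chain_oo => k.
    have /periodsP[x x01 lx] : periods (f \o clamp) (2 ^ k.+1)%N by rewrite tf; exists k.+1.
    have pf : pow2_periods (f \o clamp) by move=> q; rewrite tf => -[n ->]; exists n.
    have [N [a [b [N0 Hc _ _]]]] := pow2_chain sf pf lx.
    by exists N => //; exists a, b.
  + by apply: (odd_period_h_pol sf oq q1 (b := b)); rewrite clamp_periods //; case: tf.
Qed.
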